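(* Let $M$ be a separable existentially closed (e.c.) II$_1$ factor. Then every embedding $f:M\to M$ is approximately inner; that is, for every finite set $F\subseteq M$ and every $\epsilon>0$ there is a unitary $v\in M$ such that $\|vf(x)v^*-x\|_2<\epsilon$ for all $x\in F$.
   Context: A tracial von Neumann algebra is a von Neumann algebra equipped with a fixed faithful normal tracial state $\tau$; $\|x\|_2=\tau(x^*x)^{1/2}$; separable means separable with respect to $\|\cdot\|_2$. An embedding between tracial von Neumann algebras is a unital trace-preserving (hence injective) $*$-homomorphism; inclusions of tracial von Neumann algebras are unital and trace-preserving. For an ultrafilter $\mathcal U$, $M^{\mathcal U}$ denotes the tracial ultrapower, and the diagonal embedding $M\to M^{\mathcal U}$ sends $x$ to the class of the constant family $x$. A tracial von Neumann algebra $M$ is existentially closed (e.c.) if, whenever $M$ is contained in a tracial von Neumann algebra $N$, there is an embedding of $N$ into some ultrapower $M^{\mathcal U}$ (with $\mathcal U$ an ultrafilter on a possibly large index set; when $M$ and $N$ are separable one may use nonprincipal ultrafilters on $\mathbb N$) whose restriction to $M$ is the diagonal embedding. Every e.c. tracial von Neumann algebra is a II$_1$ factor. *)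

(* Defs.v *)
From HB Require Import structures.
From mathcomp Require Import all_boot all_order all_algebra.
From mathcomp Require Import all_classical all_reals all_analysis.
From mathcomp Require Import ring lra.
From mathcomp.real_closed Require Import complex.

Set Implicit Arguments.
Unset Strict Implicit.
Unset Printing Implicit Defensive.

Import Order.TTheory GRing.Theory Num.Theory.
Import numFieldNormedType.Exports.

Local Open Scope classical_set_scope.
Local Open Scope ring_scope.
Local Open Scope complex_scope.
Local Open Scope quotient_scope.

(* The real numbers are an arbitrary [R : realType] and the complex numbers are
   [R[i]]. In the (partial) order of [R[i]], [0 <= z] means that [z] is real
   and nonnegative, so that [e : R[i]] with [0 < e] is a positive real. *)

HB.mixin Record isStarAlgebra (R : realType) A of GRing.Algebra R[i] A := {
  star : A -> A;
  starD : forall x y, star (x + y) = star x + star y;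
  starZ : forall (a : R[i]) x, star (a *: x) = Num.conj a *: star x;
  starM : forall x y, star (x * y) = star y * star x;
  starK : forall x, star (star x) = x }.

#[short(type="starAlgType")]
HB.structure Definition StarAlgebra (R : realType) :=
  {A of GRing.Algebra R[i] A & isStarAlgebra R A}.

(* A *-algebra with a faithful tracial functional. This is the common interface
   of tracial von Neumann algebras and of their ultrapowers, in which
   embeddings are expressed; the analytic axioms are those of [tracialVNA]. *)
HB.mixin Record isTracial (R : realType) A of StarAlgebra R A := {
  tau : A -> R[i];
  tau_linear : forall (a : R[i]) x y, tau (a *: x + y) = a * tau x + tau y;
  tau1 : tau 1 = 1;
  tau_ge0 : forall x, 0 <= tau (star x * x);
  tauC : forall x y, tau (x * y) = tau (y * x);
  tau_faithful : forall x, tau (star x * x) = 0 -> x = 0 }.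

#[short(type="tracialAlgType")]
HB.structure Definition TracialAlgebra (R : realType) :=
  {A of StarAlgebra R A & isTracial R A}.

Definition norm2 (R : realType) (A : tracialAlgType R) (x : A) : R :=
  Num.sqrt (complex.Re (tau (star x * x))).

Definition unitary (R : realType) (A : starAlgType R) (v : A) : Prop :=
  star v * v = 1 /\ v * star v = 1.

(* Injectivity follows from [emb_tau] and faithfulness of the traces. *)
Record embedding (R : realType) (A B : tracialAlgType R) (f : A -> B) : Prop :=
  Embedding {
    emb_linear : forall (a : R[i]) x y, f (a *: x + y) = a *: f x + f y;
    emb1 : f 1 = 1;
    embM : forall x y, f (x * y) = f x * f y;
    emb_star : forall x, f (star x) = star (f x);
    emb_tau : forall x, tau (f x) = tau x }.

Record hilbertSpace (R : realType) := HilbertSpace {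
  hilbert_sort :> completeNormedModType R[i];
  hdot : {dot hilbert_sort for Num.conj};
  hdot_norm : forall xi, `|xi| ^+ 2 = hdot xi xi }.

Section Operators.
Variables (R : realType) (H : hilbertSpace R).

Definition op_bound (T : H -> H) (c : R[i]) : Prop :=
  0 <= c /\ forall xi, `|T xi| <= c * `|xi|.

Definition bounded_op (T : H -> H) : Prop := exists c, op_bound T c.

(* The basic neighbourhoods of the weak operator topology are given by finitely
   many matrix coefficients. *)
Definition wot_closure (S : set (H -> H)) (T : H -> H) : Prop :=
  forall (n : nat) (xi eta : 'I_n -> H) (e : R[i]), 0 < e ->
    exists2 T', S T' &
      forall k, `|hdot H (T (xi k) - T' (xi k)) (eta k)| < e.

Definition square_summable (xi : nat -> H) : Prop :=
  exists c : R[i], forall n, \sum_(j < n) `|xi j| ^+ 2 <= c.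

(* The functionals [T |-> \sum_j <T xi_j, eta_j>], for square-summable [xi] and
   [eta] (which makes the series absolutely convergent), generate the
   ultraweak topology. *)
Definition ultraweak_form (xi eta : nat -> H) (T : H -> H) : R[i] :=
  limn (series (fun j => hdot H (T (xi j)) (eta j) : R[i]^o)).

End Operators.

(* A von Neumann algebra on the Hilbert space [vna_space], i.e. a unital
   *-subalgebra of B([vna_space]) closed in the weak operator topology. The type
   [vna_alg] is the type of its elements and the injective *-homomorphism
   [vna_act] is its inclusion in B([vna_space]). The trace is a state
   ([tau_positive]: it is nonnegative on positive operators), normal, i.e.
   ultraweakly continuous ([tau_normal]); that it is tracial and faithful is
   part of [tracialAlgType]. *)
Record tracialVNA (R : realType) := TracialVNA {
  vna_alg :> tracialAlgType R;
  vna_space : hilbertSpace R;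
  vna_act : vna_alg -> {linear vna_space -> vna_space};
  act_linear : forall (a : R[i]) x y xi,
    vna_act (a *: x + y) xi = a *: vna_act x xi + vna_act y xi;
  act1 : forall xi, vna_act 1 xi = xi;
  actM : forall x y xi, vna_act (x * y) xi = vna_act x (vna_act y xi);
  act_star : forall x xi eta,
    hdot vna_space (vna_act (star x) xi) eta =
    hdot vna_space xi (vna_act x eta);
  act_bounded : forall x, bounded_op (vna_act x);
  act_inj : forall x, (forall xi, vna_act x xi = 0) -> x = 0;
  act_wot_closed : forall T : {linear vna_space -> vna_space},
    bounded_op T ->
    wot_closure (range (fun x => vna_act x : vna_space -> vna_space)) T ->
    exists x, vna_act x =1 T;
  tau_positive : forall x,
    (forall xi, 0 <= hdot vna_space (vna_act x xi) xi) -> 0 <= tau x;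
  tau_normal : forall e : R[i], 0 < e ->
    exists n (xi eta : 'I_n -> nat -> vna_space) (d : R[i]),
      [/\ 0 < d,
          forall k, square_summable (xi k) /\ square_summable (eta k) &
          forall x,
            (forall k, `|ultraweak_form (xi k) (eta k) (vna_act x)| < d) ->
            `|tau x| < e] }.

Section TraceTheory.
Variables (R : realType) (A : tracialAlgType R).
Implicit Types (x y : A) (a : R[i]).

Lemma star0 : star (0 : A) = 0.
Proof. by have := @starZ R A 0 0; rewrite !scale0r rmorph0 scale0r. Qed.

Lemma starN x : star (- x) = - star x.
Proof. by rewrite -scaleN1r starZ rmorphN1 scaleN1r. Qed.

Lemma starB x y : star (x - y) = star x - star y.
Proof. by rewrite starD starN. Qed.

Lemma star1 : star (1 : A) = 1.
Proof. by rewrite -[LHS]mulr1 -{2}[1](starK (1 : A)) -starM mulr1 starK. Qed.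

Lemma tauD x y : tau (x + y) = tau x + tau y.
Proof. by rewrite -{1}[x]scale1r tau_linear mul1r. Qed.

Lemma tau0 : tau (0 : A) = 0.
Proof. by apply: (addrI (tau (0 : A))); rewrite -tauD !addr0. Qed.

Lemma tauZ a x : tau (a *: x) = a * tau x.
Proof. by rewrite -[a *: x]addr0 tau_linear tau0 addr0. Qed.

Lemma tauN x : tau (- x) = - tau x.
Proof. by rewrite -scaleN1r tauZ mulN1r. Qed.

Lemma tauB x y : tau (x - y) = tau x - tau y.
Proof. by rewrite tauD tauN. Qed.


Definition norm2sq x : R := complex.Re (tau (star x * x)).

Lemma tau_sqE x : tau (star x * x) = (norm2sq x)%:C.
Proof.
rewrite /norm2sq; have := tau_ge0 x.
by case: (tau _) => a b; rewrite lecE /= => /andP[/eqP -> _].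
Qed.

Lemma norm2sq_ge0 x : 0 <= norm2sq x.
Proof. by have := tau_ge0 x; rewrite tau_sqE lecR. Qed.

Lemma norm2_ge0 x : 0 <= norm2 x.
Proof. exact: sqrtr_ge0. Qed.

Lemma sqr_norm2 x : norm2 x ^+ 2 = norm2sq x.
Proof. by rewrite sqr_sqrtr ?norm2sq_ge0. Qed.

Lemma norm2sq0 : norm2sq (0 : A) = 0.
Proof. by rewrite /norm2sq mulr0 tau0. Qed.

Lemma norm2sq_star x : norm2sq (star x) = norm2sq x.
Proof. by rewrite /norm2sq starK tauC. Qed.

Lemma norm2sqN x : norm2sq (- x) = norm2sq x.
Proof. by rewrite /norm2sq starN mulrNN. Qed.


Lemma norm2sqD x y : norm2sq (x + y) <= 2 * (norm2sq x + norm2sq y).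
Proof.
suff <- : norm2sq (x + y) + norm2sq (x - y) = 2 * (norm2sq x + norm2sq y).
  by rewrite lerDl norm2sq_ge0.
apply: (@complexI R); rewrite rmorphM !rmorphD /= -!tau_sqE.
rewrite starB starD !(mulrDl, mulrDr, mulNr, mulrN) !(tauD, tauN).
ring.
Qed.

Lemma tau_shift x (z : R[i]) :
  tau (star (x + z%:A) * (x + z%:A)) =
  tau (star x * x) + z * tau (star x) + Num.conj z * tau x + z * Num.conj z.
Proof.
rewrite starD starZ star1 !(mulrDl, mulrDr) -!scalerAl -!scalerAr !mul1r !mulr1.
rewrite !(tauD, tauZ) tau1; ring.
Qed.

Lemma tau_star x : tau (star x) = Num.conj (tau x).
Proof.
have Im0 (z : A) : complex.Im (tau (star z * z)) = 0 by rewrite tau_sqE.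
have := Im0 (x + 1%:A); have := Im0 (x + ('i : R[i])%:A).
rewrite !tau_shift tau_sqE.
case: (tau (star x)) => a b; case: (tau x) => c d /=.
rewrite /= => h1 h2; apply/eqP; rewrite eq_complex /=; apply/andP.
by split; apply/eqP; lra.
Qed.

Lemma norm2sqZ a x :
  norm2sq (a *: x) = (complex.Re a ^+ 2 + complex.Im a ^+ 2) * norm2sq x.
Proof.
apply: (@complexI R); rewrite rmorphM /= add_Re2_Im2 -!tau_sqE sqr_normc.
by rewrite starZ -scalerAl -scalerAr scalerA tauZ [_^*%R * _]mulrC.
Qed.

Lemma le_tau_norm2sq x :
  complex.Re (tau x) ^+ 2 + complex.Im (tau x) ^+ 2 <= norm2sq x.
Proof.
rewrite -subr_ge0.
have := norm2sq_ge0 (x + (- tau x)%:A).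
rewrite /norm2sq tau_shift tau_star tau_sqE.
case: (tau x) => c d /=; lra.
Qed.

Lemma norm2sq1 : norm2sq (1 : A) = 1.
Proof. by rewrite /norm2sq star1 mul1r tau1. Qed.

End TraceTheory.

Section VNATheory.
Variables (R : realType) (M : tracialVNA R).
Implicit Types (x y : M) (c d : R[i]).
Local Notation H := (vna_space M).
Local Notation "''[' u , v ]" := (hdot H u v).


Lemma actD x y xi : vna_act (x + y) xi = vna_act x xi + vna_act y xi.
Proof. by have := act_linear 1 x y xi; rewrite !scale1r. Qed.

Lemma act0 xi : vna_act (0 : M) xi = 0.
Proof. by apply: (addrI (vna_act (0 : M) xi)); rewrite -actD !addr0. Qed.

Lemma actZ c x xi : vna_act (c *: x) xi = c *: vna_act x xi.
Proof. by rewrite -[c *: x]addr0 act_linear act0 addr0. Qed.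

Lemma actN x xi : vna_act (- x) xi = - vna_act x xi.
Proof. by rewrite -scaleN1r actZ scaleN1r. Qed.

Lemma hdot_star x (xi eta : H) :
  '[vna_act x xi, eta] = '[xi, vna_act (star x) eta].
Proof. by rewrite -act_star starK. Qed.

Lemma op_bound0 : op_bound (vna_act (0 : M)) 0.
Proof. by split=> // xi; rewrite act0 normr0 mul0r. Qed.

Lemma op_bound1 : op_bound (vna_act (1 : M)) 1.
Proof. by split=> // xi; rewrite act1 mul1r. Qed.

Lemma op_boundD x y c d :
  op_bound (vna_act x) c -> op_bound (vna_act y) d ->
  op_bound (vna_act (x + y)) (c + d).
Proof.
move=> [c0 xc] [d0 yd]; split=> [|xi]; first exact: addr_ge0.
by rewrite actD mulrDl (le_trans (ler_normD _ _))// lerD.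
Qed.

Lemma op_boundN x c : op_bound (vna_act x) c -> op_bound (vna_act (- x)) c.
Proof. by move=> [c0 xc]; split=> // xi; rewrite actN normrN. Qed.

Lemma op_boundM x y c d :
  op_bound (vna_act x) c -> op_bound (vna_act y) d ->
  op_bound (vna_act (x * y)) (c * d).
Proof.
move=> [c0 xc] [d0 yd]; split=> [|xi]; first exact: mulr_ge0.
by rewrite actM -mulrA (le_trans (xc _))// ler_wpM2l.
Qed.

Lemma op_boundZ a x c :
  op_bound (vna_act x) c -> op_bound (vna_act (a *: x)) (`|a| * c).
Proof.
move=> [c0 xc]; split=> [|xi]; first exact: mulr_ge0.
by rewrite actZ normrZ -mulrA ler_wpM2l.
Qed.


Lemma op_bound_star x c :
  op_bound (vna_act x) c -> op_bound (vna_act (star x)) c.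
Proof.
move=> [c0 xc]; split=> // xi; set eta := vna_act (star x) xi.
have E : '[vna_act x eta, xi] = `|eta| ^+ 2 by rewrite hdot_norm hdot_star.
have {xc} ub : '[vna_act x eta, vna_act x eta] <= c ^+ 2 * `|eta| ^+ 2.
  by rewrite -hdot_norm -exprMn lerXn2r ?nnegrE ?mulr_ge0.
have c2 : Num.conj (c ^+ 2) = c ^+ 2 by rewrite geC0_conj ?exprn_ge0.
have Ed : '[vna_act x eta, c ^+ 2 *: xi] = c ^+ 2 * `|eta| ^+ 2.
  by rewrite linearZr_LR /= -[in RHS]c2 -E.
have := dnorm_ge0 (hdot H) (vna_act x eta - c ^+ 2 *: xi).
rewrite dnormB Ed dnormZ -!hdot_norm.
rewrite geC0_conj; last by rewrite mulr_ge0 ?exprn_ge0.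
rewrite ger0_norm ?exprn_ge0// => h.
have {}h : c ^+ 2 * `|eta| ^+ 2 <= c ^+ 2 * (c * `|xi|) ^+ 2.
  rewrite exprMn -subr_ge0; move: ub; rewrite -subr_ge0.
  move=> /(addr_ge0 h); congr (0 <= _).
  by rewrite -hdot_norm; ring.
have [c_eq0|c_neq0] := eqVneq c 0.
  move: ub; rewrite c_eq0 expr0n /= mul0r => ub.
  have /eqP : '[vna_act x eta, vna_act x eta] = 0.
    by apply/eqP; rewrite eq_le ub dnorm_ge0.
  rewrite dnorm_eq0 => /eqP u0.
  move: E; rewrite u0 linear0l => /esym/eqP; rewrite sqrf_eq0 => /eqP ->.
  by rewrite mul0r.
have c_gt0 : 0 < c by rewrite lt_def c_neq0.
move: h; rewrite ler_pM2l ?exprn_gt0// ler_pXn2r ?nnegrE ?mulr_ge0//.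
Qed.

Lemma norm2sqM_bound x y (c : R) :
  op_bound (vna_act x) c%:C -> norm2sq (x * y) <= c ^+ 2 * norm2sq y.
Proof.
move=> [c0 xc]; rewrite -subr_ge0.
rewrite -lecR rmorphB rmorphM /= -!tau_sqE.
have -> : (c ^+ 2)%:C * tau (star y * y) - tau (star (x * y) * (x * y)) =
    tau (star y * ((c ^+ 2)%:C%:A - star x * x) * y).
  rewrite mulrBr mulrBl tauB starM -[star y * _%:A]scalerAr mulr1.
  rewrite -scalerAl tauZ.
  by rewrite !mulrA.
apply: tau_positive => xi.
rewrite !actM act_star actD actN actZ act1 actM linearBl /= subr_ge0.
rewrite act_star -hdot_norm linearZl_LR /= -hdot_norm rmorphXn -exprMn.
by rewrite lerXn2r ?nnegrE ?mulr_ge0.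
Qed.

Lemma op_boundR x c :
  op_bound (vna_act x) c -> exists d : R, op_bound (vna_act x) d%:C.
Proof.
case: c => a b [c0 xc]; exists a.
by move: c0 (c0); rewrite {1}lecE /= => /andP[/eqP b0 _]; rewrite b0 in xc *.
Qed.

Lemma norm2sq_le_bound x (c : R) :
  op_bound (vna_act x) c%:C -> norm2sq x <= c ^+ 2.
Proof. by move/(norm2sqM_bound 1); rewrite mulr1 norm2sq1 mulr1. Qed.

End VNATheory.

Section UltraLimit.
Variables (R : realType) (I : Type) (U : set_system I).
Hypothesis UU : UltraFilter U.
#[local] Existing Instance ultra_proper.

Lemma ultra_cvg (f : I -> R) (b : R) : (forall i, `|f i| <= b) -> cvg (f @ U).
Proof.
move=> fb; have /= := @segment_compact R (- b) b (f @ U) _.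
case=> [|p [_ fp]]; first by apply: nearW => i; rewrite /= in_itv /= -ler_norml.
apply/cvg_ex; exists p => V pV.
have [//|nV] := in_ultra_setVsetC (f @^-1` V) UU.
by have [y []] := fp (~` V) V nV pV.
Qed.

(* The limit is taken coordinatewise. *)
Definition ulim (f : I -> R[i]) : R[i] :=
  lim ((fun i => complex.Re (f i)) @ U) +i*
  lim ((fun i => complex.Im (f i)) @ U).

Definition ucvg (f : I -> R[i]) (l : R[i]) : Prop :=
  (fun i => complex.Re (f i)) @ U --> complex.Re l /\
  (fun i => complex.Im (f i)) @ U --> complex.Im l.

Lemma ulimE f l : ucvg f l -> ulim f = l.
Proof.
by case: l => a b [/= /cvg_lim fa /cvg_lim fb]; rewrite /ulim fa ?fb.
Qed.

Lemma ucvgP f (b : R) :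
  (forall i, complex.Re (f i) ^+ 2 + complex.Im (f i) ^+ 2 <= b ^+ 2) ->
  ucvg f (ulim f).
Proof.
move=> fb; split=> /=.
- apply: (@ultra_cvg _ `|b|) => i.
  rewrite -ler_sqr ?nnegrE// !real_normK ?num_real//.
  by rewrite (le_trans _ (fb i))// lerDl sqr_ge0.
- apply: (@ultra_cvg _ `|b|) => i.
  rewrite -ler_sqr ?nnegrE// !real_normK ?num_real//.
  by rewrite (le_trans _ (fb i))// lerDr sqr_ge0.
Qed.

Lemma ucvg_lin (a : R[i]) f g l m : ucvg f l -> ucvg g m ->
  ucvg (fun i => a * f i + g i) (a * l + m).
Proof.
move=> [f1 f2] [g1 g2]; case: a l m f1 f2 g1 g2 => a b [l1 l2] [m1 m2] /=.
move=> f1 f2 g1 g2; split => /=.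
- have -> : (fun i => complex.Re ((a +i* b) * f i + g i)) =
      (fun i => a * complex.Re (f i) - b * complex.Im (f i) + complex.Re (g i)).
    by apply/funext => i; case: (f i) (g i) => ? ? [].
  by apply: cvgD => //; apply: cvgB; apply: cvgMl_tmp.
- have -> : (fun i => complex.Im ((a +i* b) * f i + g i)) =
      (fun i => a * complex.Im (f i) + b * complex.Re (f i) + complex.Im (g i)).
    by apply/funext => i; case: (f i) (g i) => ? ? [].
  by apply: cvgD => //; apply: cvgD; apply: cvgMl_tmp.
Qed.

Lemma ucvg_uniq f l m : ucvg f l -> ucvg f m -> l = m.
Proof. by move=> /ulimE <- /ulimE. Qed.

Lemma ucvg_cst (c : R[i]) : ucvg (fun=> c) c.
Proof. by split; exact: cvg_cst. Qed.

Lemma ucvg_ge0 f l : (forall i, 0 <= f i) -> ucvg f l -> 0 <= l.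
Proof.
move=> f0 [fl1 fl2]; rewrite lecE /=; apply/andP; split.
  apply/eqP/(cvg_unique _ fl2); first exact: Rhausdorff.
  have -> : (fun i => complex.Im (f i)) = (fun=> 0).
    by apply/funext => i; have := f0 i; rewrite lecE /= => /andP[/eqP].
  exact: cvg_cst.
rewrite -(cvg_lim _ fl1)//; apply: limr_ge.
  by apply/cvg_ex; eexists; exact: fl1.
by apply: nearW => i; have := f0 i; rewrite lecE /= => /andP[].
Qed.

End UltraLimit.

Record ultrafilterOn (I : Type) := UltrafilterOn {
  ultra_set :> set_system I;
  ultra_setP : UltraFilter ultra_set }.
#[global] Existing Instance ultra_setP.
#[global] Existing Instance ultra_proper.

Section BoundedFamilies.
Variables (R : realType) (M : tracialVNA R) (I : Type).

(* Families that are bounded for the operator norm of [M]. *)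
Definition bounded_family : {pred (I -> M)} :=
  fun x => `[< exists c, forall i, op_bound (vna_act (x i)) c >].

Lemma bounded_family_zmod : zmod_closed bounded_family.
Proof.
split=> [|x y /asboolP[c xc] /asboolP[d yd]]; apply/asboolP.
  by exists 0 => i; exact: op_bound0.
by exists (c + d) => i; apply: op_boundD => //; exact: op_boundN.
Qed.

HB.instance Definition _ :=
  GRing.isZmodClosed.Build (I -> M) bounded_family bounded_family_zmod.

Record linfty := Linfty {
  linfty_val :> I -> M;
  linftyP : linfty_val \in bounded_family }.

HB.instance Definition _ := [isSub for linfty_val].
HB.instance Definition _ := [Choice of linfty by <:].
HB.instance Definition _ := [SubChoice_isSubZmodule of linfty by <:].

Lemma linfty_ubP (x : linfty) :
  exists c : R, forall i, op_bound (vna_act (x i)) c%:C.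
Proof.
have /asboolP[[a b] xc] := linftyP x.
have [[i0]|nI] := pselect (inhabited I); last first.
  by exists 0 => i; case: nI.
have b0 : b = 0 by have [] := xc i0; rewrite lecE /= => /andP[/eqP].
by exists a; rewrite -[a%:C]/(a +i* 0) -b0.
Qed.

Lemma linfty_mk (x : I -> M) (c : R) :
  (forall i, op_bound (vna_act (x i)) c%:C) -> x \in bounded_family.
Proof. by move=> xc; apply/asboolP; exists c%:C. Qed.

Lemma linfty_cst_subproof (x : M) : (fun _ : I => x) \in bounded_family.
Proof. by have [c xc] := act_bounded x; apply/asboolP; exists c. Qed.

Lemma linfty_mul_subproof (x y : linfty) :
  (fun i => x i * y i) \in bounded_family.
Proof.
have [c xc] := linfty_ubP x; have [d yd] := linfty_ubP y.
apply: (@linfty_mk _ (c * d)) => i; rewrite rmorphM; exact: op_boundM.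
Qed.

Lemma linfty_scale_subproof (a : R[i]) (x : linfty) :
  (fun i => a *: x i) \in bounded_family.
Proof.
have /asboolP[c xc] := linftyP x; apply/asboolP; exists (`|a| * c) => i.
exact: op_boundZ.
Qed.

Lemma linfty_star_subproof (x : linfty) :
  (fun i => star (x i)) \in bounded_family.
Proof.
have /asboolP[c xc] := linftyP x; apply/asboolP; exists c => i.
exact: op_bound_star.
Qed.

Definition linfty_cst x := Linfty (linfty_cst_subproof x).
Definition linfty_mul x y := Linfty (linfty_mul_subproof x y).
Definition linfty_scale a x := Linfty (linfty_scale_subproof a x).
Definition linfty_star x := Linfty (linfty_star_subproof x).

Lemma linfty_eqP (x y : linfty) : (forall i, x i = y i) -> x = y.
Proof. by move=> xy; apply/val_inj/funext. Qed.

Lemma linfty_valD (x y : linfty) i : (x + y) i = x i + y i.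
Proof. by []. Qed.

Lemma linfty_valB (x y : linfty) i : (x - y) i = x i - y i.
Proof. by []. Qed.

Definition linfty_valE := (linfty_valD, linfty_valB).

Variable U : ultrafilterOn I.

Definition null_family : {pred linfty} :=
  fun x => `[< (fun i => norm2 (x i)) @ ultra_set U --> (0 : R) >].

Lemma null_familyP (x : linfty) :
  reflect ((fun i => norm2sq (x i)) @ ultra_set U --> (0 : R))
    (x \in null_family).
Proof.
apply: (iffP (asboolP _)) => h.
  have -> : (fun i => norm2sq (x i)) =
      (fun i => norm2 (x i)) \* (fun i => norm2 (x i)).
    by apply/funext => i /=; rewrite -sqr_norm2 expr2.
  by rewrite -[X in _ --> X](mulr0 0); exact: cvgM.
have := @cvg_comp _ _ _ _ (@Num.sqrt R) _ _ _ h (@sqrt_continuous R 0).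
by rewrite sqrtr0.
Qed.

Lemma null_family_le (x : linfty) (f : I -> R) : f @ ultra_set U --> (0 : R) ->
  (forall i, norm2sq (x i) <= f i) -> x \in null_family.
Proof.
move=> f0 xf; apply/null_familyP; apply: squeeze_cvgr (cvg_cst 0) f0.
by apply: nearW => i; rewrite norm2sq_ge0 xf.
Qed.

Lemma null_family_zmod : zmod_closed null_family.
Proof.
split=> [|x y /null_familyP x0 /null_familyP y0].
  apply: (@null_family_le _ (fun=> 0)); first exact: cvg_cst.
  by move=> i; rewrite norm2sq0.
apply: (@null_family_le _ (fun i => 2 * (norm2sq (x i) + norm2sq (y i)))).
  rewrite -[X in _ --> X](mulr0 2) -[X in 2 * X](addr0 0).
  by apply: cvgMl_tmp; exact: cvgD.
by move=> i; rewrite (le_trans (norm2sqD _ _))// norm2sqN.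
Qed.

HB.instance Definition _ :=
  GRing.isZmodClosed.Build linfty null_family null_family_zmod.

Lemma null_family_mull x y :
  y \in null_family -> linfty_mul x y \in null_family.
Proof.
move=> /null_familyP y0; have [c xc] := linfty_ubP x.
apply: (@null_family_le _ (fun i => c ^+ 2 * norm2sq (y i))).
  by rewrite -[X in _ --> X](mulr0 (c ^+ 2)); exact: cvgMl_tmp.
by move=> i; exact: norm2sqM_bound.
Qed.

Lemma null_family_star x : x \in null_family -> linfty_star x \in null_family.
Proof.
move=> /null_familyP x0; apply: null_family_le x0 _ => i.
by rewrite norm2sq_star.
Qed.

Lemma linfty_starK x : linfty_star (linfty_star x) = x.
Proof. by apply: linfty_eqP => i /=; rewrite starK. Qed.

Lemma linfty_starM x y :
  linfty_star (linfty_mul x y) = linfty_mul (linfty_star y) (linfty_star x).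
Proof. by apply: linfty_eqP => i /=; rewrite starM. Qed.

Lemma null_family_mulr x y :
  x \in null_family -> linfty_mul x y \in null_family.
Proof.
move=> /null_family_star xS; rewrite -[linfty_mul x y]linfty_starK linfty_starM.
exact/null_family_star/null_family_mull.
Qed.

Lemma null_family_scale a x :
  x \in null_family -> linfty_scale a x \in null_family.
Proof.
move=> /null_familyP x0.
apply: (@null_family_le _ (fun i =>
  (complex.Re a ^+ 2 + complex.Im a ^+ 2) * norm2sq (x i))).
  by rewrite -[X in _ --> X](mulr0 (complex.Re a ^+ 2 + complex.Im a ^+ 2));
    exact: cvgMl_tmp.
by move=> i; rewrite norm2sqZ.
Qed.

Definition linfty_tau (x : linfty) : R[i] := ulim U (fun i => tau (x i)).


Lemma linfty_tauP (x : linfty) : ucvg U (fun i => tau (x i)) (linfty_tau x).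
Proof.
have [c xc] := linfty_ubP x; apply: (@ucvgP _ _ _ _ _ c) => i.
exact: le_trans (le_tau_norm2sq _) (norm2sq_le_bound (xc i)).
Qed.

Lemma linfty_tau_null (x : linfty) : x \in null_family -> linfty_tau x = 0.
Proof.
move=> /null_familyP x0.
have sq0 (f : I -> R) : (forall i, f i ^+ 2 <= norm2sq (x i)) ->
    f @ ultra_set U --> (0 : R).
  move=> fx; apply/norm_cvg0P.
  have := @cvg_comp _ _ _ _ (@Num.sqrt R) _ _ _ x0 (@sqrt_continuous R 0).
  rewrite sqrtr0; apply: squeeze_cvgr (cvg_cst 0).
  by apply: nearW => i; rewrite normr_ge0 /= -sqrtr_sqr ler_wsqrtr.
apply: ulimE; split=> /=; apply: sq0 => i;
  apply: le_trans (le_tau_norm2sq _); by rewrite ?lerDl ?lerDr sqr_ge0.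
Qed.

Lemma linfty_tau_linear a (x y z : linfty) :
  (forall i, z i = a *: x i + y i) ->
  linfty_tau z = a * linfty_tau x + linfty_tau y.
Proof.
move=> zE; apply: ulimE.
have := ucvg_lin (ultra_setP U) a (linfty_tauP x) (linfty_tauP y).
by under eq_fun do rewrite -tau_linear -zE.
Qed.

Lemma linfty_tau_eq (x y : linfty) :
  x - y \in null_family -> linfty_tau x = linfty_tau y.
Proof.
move=> /linfty_tau_null xy0.
rewrite (@linfty_tau_linear 1 (x - y) y) ?xy0 ?mulr0 ?add0r// => i.
by rewrite scale1r /= subrK.
Qed.

Lemma linfty_tau_faithful (x : linfty) :
  linfty_tau (linfty_mul (linfty_star x) x) = 0 -> x \in null_family.
Proof.
move=> h; have [h1 _] := linfty_tauP (linfty_mul (linfty_star x) x).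
by apply/null_familyP; move: h1; rewrite h.
Qed.

(* The tracial ultrapower: bounded families modulo those whose 2-norm tends to 0
   along [U], with pointwise operations and trace [lim_U tau (x i)]. *)
Definition ultrapower : Type := {ideal_quot null_family}.
HB.instance Definition _ := GRing.Zmodule.on ultrapower.
HB.instance Definition _ := EqQuotient.on ultrapower.

Definition ultra_class (x : linfty) : ultrapower := \pi_ultrapower x.
Local Notation cls := ultra_class.

Lemma ultra_classP (x y : linfty) :
  cls x = cls y <-> x - y \in null_family.
Proof. by split=> [/eqmodP|h]; [|apply/eqmodP]; rewrite /= Quotient.equivE. Qed.

Lemma ultra_classE (u : ultrapower) : cls (repr u) = u.
Proof. exact: reprK. Qed.

Lemma ultra_classD x y : cls (x + y) = cls x + cls y.
Proof. exact: (raddfD (\pi_ultrapower)). Qed.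

Definition ultra_mul (u v : ultrapower) := cls (linfty_mul (repr u) (repr v)).
Definition ultra_scale a (u : ultrapower) := cls (linfty_scale a (repr u)).
Definition ultra_star (u : ultrapower) := cls (linfty_star (repr u)).
Definition ultra_tau (u : ultrapower) := linfty_tau (repr u).
Definition diag_embedding (x : M) : ultrapower := cls (linfty_cst x).

Lemma repr_class x : x - repr (cls x) \in null_family.
Proof. by apply/ultra_classP; rewrite ultra_classE. Qed.

Lemma ultra_mulE x y : ultra_mul (cls x) (cls y) = cls (linfty_mul x y).
Proof.
apply/esym/ultra_classP; set x' := repr _; set y' := repr _.
have -> : linfty_mul x y - linfty_mul x' y' =
    linfty_mul (x - x') y + linfty_mul x' (y - y').
  by apply: linfty_eqP => i;
  rewrite ?linfty_valE /= ?linfty_valE mulrBl mulrBr addrA subrK.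
apply: rpredD; first exact/null_family_mulr/repr_class.
exact/null_family_mull/repr_class.
Qed.

Lemma ultra_scaleE a x : ultra_scale a (cls x) = cls (linfty_scale a x).
Proof.
apply/esym/ultra_classP; set x' := repr _.
have -> : linfty_scale a x - linfty_scale a x' = linfty_scale a (x - x').
  by apply: linfty_eqP => i;
  rewrite ?linfty_valE /= ?linfty_valE scalerBr.
exact/null_family_scale/repr_class.
Qed.

Lemma ultra_starE x : ultra_star (cls x) = cls (linfty_star x).
Proof.
apply/esym/ultra_classP; set x' := repr _.
have -> : linfty_star x - linfty_star x' = linfty_star (x - x').
  by apply: linfty_eqP => i;
  rewrite ?linfty_valE /= ?linfty_valE starB.
exact/null_family_star/repr_class.
Qed.

Lemma ultra_tauE x : ultra_tau (cls x) = linfty_tau x.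
Proof. exact/esym/linfty_tau_eq/repr_class. Qed.

Lemma ultra_ind (P : ultrapower -> Prop) :
  (forall x, P (cls x)) -> forall u, P u.
Proof. by move=> Pc u; rewrite -(ultra_classE u). Qed.

Definition ultraE := (ultra_mulE, ultra_scaleE, ultra_starE, ultra_tauE).

Lemma ultra_mulA : associative ultra_mul.
Proof.
elim/ultra_ind=> x; elim/ultra_ind=> y; elim/ultra_ind=> z; rewrite !ultraE.
by congr cls; apply: linfty_eqP => i;
  rewrite ?linfty_valE /= ?linfty_valE mulrA.
Qed.

Lemma ultra_mul1l : left_id (diag_embedding 1) ultra_mul.
Proof.
elim/ultra_ind=> x; rewrite ultraE.
by congr cls; apply: linfty_eqP => i;
  rewrite ?linfty_valE /= ?linfty_valE mul1r.
Qed.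

Lemma ultra_mul1r : right_id (diag_embedding 1) ultra_mul.
Proof.
elim/ultra_ind=> x; rewrite ultraE.
by congr cls; apply: linfty_eqP => i;
  rewrite ?linfty_valE /= ?linfty_valE mulr1.
Qed.

Lemma ultra_mulDl : left_distributive ultra_mul +%R.
Proof.
elim/ultra_ind=> x; elim/ultra_ind=> y; elim/ultra_ind=> z.
rewrite -ultra_classD !ultraE -ultra_classD.
by congr cls; apply: linfty_eqP => i;
  rewrite ?linfty_valE /= ?linfty_valE mulrDl.
Qed.

Lemma ultra_mulDr : right_distributive ultra_mul +%R.
Proof.
elim/ultra_ind=> x; elim/ultra_ind=> y; elim/ultra_ind=> z.
rewrite -ultra_classD !ultraE -ultra_classD.
by congr cls; apply: linfty_eqP => i;
  rewrite ?linfty_valE /= ?linfty_valE mulrDr.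
Qed.

Lemma ultra_cst_tau (x : M) : ultra_tau (diag_embedding x) = tau x.
Proof. by rewrite ultraE; apply/ulimE/ucvg_cst. Qed.

Lemma ultra_class0 : cls 0 = 0.
Proof. by apply: (addrI (cls 0)); rewrite -ultra_classD !addr0. Qed.

Lemma ultra_tau0 : ultra_tau 0 = 0.
Proof. by rewrite -ultra_class0 ultraE linfty_tau_null ?rpred0. Qed.

Lemma ultra_one_neq0 : diag_embedding 1 != 0.
Proof.
apply/eqP => /(congr1 ultra_tau); rewrite ultra_cst_tau tau1 ultra_tau0.
by move/eqP; rewrite oner_eq0.
Qed.

HB.instance Definition _ := GRing.Zmodule_isNzRing.Build ultrapower
  ultra_mulA ultra_mul1l ultra_mul1r ultra_mulDl ultra_mulDr ultra_one_neq0.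

Lemma ultra_scaleA a b u :
  ultra_scale a (ultra_scale b u) = ultra_scale (a * b) u.
Proof.
elim/ultra_ind: u => x; rewrite !ultraE.
by congr cls; apply: linfty_eqP => i;
  rewrite ?linfty_valE /= ?linfty_valE scalerA.
Qed.

Lemma ultra_scale1 : left_id 1 ultra_scale.
Proof.
elim/ultra_ind=> x; rewrite !ultraE.
by congr cls; apply: linfty_eqP => i;
  rewrite ?linfty_valE /= ?linfty_valE scale1r.
Qed.

Lemma ultra_scaleDr : right_distributive ultra_scale +%R.
Proof.
move=> a; elim/ultra_ind=> x; elim/ultra_ind=> y.
rewrite -ultra_classD !ultraE -ultra_classD.
by congr cls; apply: linfty_eqP => i;
  rewrite ?linfty_valE /= ?linfty_valE scalerDr.
Qed.

Lemma ultra_scaleDl u : {morph ultra_scale^~ u : a b / a + b}.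
Proof.
elim/ultra_ind: u => x a b; rewrite !ultraE -ultra_classD.
by congr cls; apply: linfty_eqP => i;
  rewrite ?linfty_valE /= ?linfty_valE scalerDl.
Qed.

HB.instance Definition _ := GRing.Zmodule_isLmodule.Build R[i] ultrapower
  ultra_scaleA ultra_scale1 ultra_scaleDr ultra_scaleDl.

Lemma ultra_scaleAl a (u v : ultrapower) : a *: (u * v) = (a *: u) * v.
Proof.
elim/ultra_ind: u => x; elim/ultra_ind: v => y.
rewrite /GRing.mul /GRing.scale /= !ultraE.
by congr cls; apply: linfty_eqP => i;
  rewrite ?linfty_valE /= ?linfty_valE scalerAl.
Qed.

HB.instance Definition _ :=
  GRing.Lmodule_isLalgebra.Build R[i] ultrapower ultra_scaleAl.

Lemma ultra_scaleAr a (u v : ultrapower) : a *: (u * v) = u * (a *: v).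
Proof.
elim/ultra_ind: u => x; elim/ultra_ind: v => y.
rewrite /GRing.mul /GRing.scale /= !ultraE.
by congr cls; apply: linfty_eqP => i;
  rewrite ?linfty_valE /= ?linfty_valE scalerAr.
Qed.

HB.instance Definition _ :=
  GRing.Lalgebra_isAlgebra.Build R[i] ultrapower ultra_scaleAr.

Lemma ultra_starD (u v : ultrapower) :
  ultra_star (u + v) = ultra_star u + ultra_star v.
Proof.
elim/ultra_ind: u => x; elim/ultra_ind: v => y.
rewrite -ultra_classD !ultraE -ultra_classD.
by congr cls; apply: linfty_eqP => i;
  rewrite ?linfty_valE /= ?linfty_valE starD.
Qed.

Lemma ultra_starZ (a : R[i]) (u : ultrapower) :
  ultra_star (a *: u) = Num.conj a *: ultra_star u.
Proof.
elim/ultra_ind: u => x; rewrite /GRing.scale /= !ultraE.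
by congr cls; apply: linfty_eqP => i;
  rewrite ?linfty_valE /= ?linfty_valE starZ.
Qed.

Lemma ultra_starM (u v : ultrapower) :
  ultra_star (u * v) = ultra_star v * ultra_star u.
Proof.
elim/ultra_ind: u => x; elim/ultra_ind: v => y.
by rewrite /GRing.mul /= !ultraE linfty_starM.
Qed.

Lemma ultra_starK : involutive ultra_star.
Proof. by elim/ultra_ind=> x; rewrite !ultraE linfty_starK. Qed.

HB.instance Definition _ := isStarAlgebra.Build R ultrapower
  ultra_starD ultra_starZ ultra_starM ultra_starK.

Lemma ultra_tau_linear (a : R[i]) (u v : ultrapower) :
  ultra_tau (a *: u + v) = a * ultra_tau u + ultra_tau v.
Proof.
elim/ultra_ind: u => x; elim/ultra_ind: v => y.
have -> : a *: cls x = cls (linfty_scale a x) by rewrite -ultra_scaleE.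
by rewrite -ultra_classD !ultraE; exact: linfty_tau_linear.
Qed.

Lemma ultra_tau1 : ultra_tau 1 = 1.
Proof. by rewrite -[1]/(diag_embedding 1) ultra_cst_tau tau1. Qed.

Lemma ultra_tau_ge0 (u : ultrapower) : 0 <= ultra_tau (star u * u).
Proof.
elim/ultra_ind: u => x.
have -> : star (cls x) * cls x = cls (linfty_mul (linfty_star x) x).
  by rewrite -ultra_mulE -ultra_starE.
rewrite ultraE; apply: ucvg_ge0 (linfty_tauP _) => i; exact: tau_ge0.
Qed.

Lemma ultra_tauC (u v : ultrapower) : ultra_tau (u * v) = ultra_tau (v * u).
Proof.
elim/ultra_ind: u => x; elim/ultra_ind: v => y; rewrite /GRing.mul /= !ultraE.
by rewrite /linfty_tau; under eq_fun do rewrite /= tauC.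
Qed.

Lemma ultra_tau_faithful (u : ultrapower) : ultra_tau (star u * u) = 0 -> u = 0.
Proof.
elim/ultra_ind: u => x.
have -> : star (cls x) * cls x = cls (linfty_mul (linfty_star x) x).
  by rewrite -ultra_mulE -ultra_starE.
rewrite ultraE => /linfty_tau_faithful x0.
by rewrite -ultra_class0; apply/ultra_classP; rewrite subr0.
Qed.

HB.instance Definition _ := isTracial.Build R ultrapower
  ultra_tau_linear ultra_tau1 ultra_tau_ge0 ultra_tauC ultra_tau_faithful.

End BoundedFamilies.

(* Index sets of ultrafilters; [carrier_index] makes this universe contain the
   carriers of all tracial von Neumann algebras, so that index sets may be as
   large as needed. *)
Definition index_type := Type.
Definition carrier_index (R : realType) (N : tracialVNA R) : index_type := N.

Definition existentially_closed (R : realType) (M : tracialVNA R) : Prop :=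
  forall (N : tracialVNA R) (j : M -> N), embedding j ->
    exists (I : index_type) (U : ultrafilterOn I) (g : N -> ultrapower M U),
      embedding g /\ forall x : M, g (j x) = diag_embedding U x.

Definition separable_tracial (R : realType) (A : tracialAlgType R) : Prop :=
  exists2 D : set A, countable D &
    forall (x : A) (e : R), 0 < e -> exists2 d, D d & norm2 (x - d) < e.

Definition is_factor (R : realType) (A : starAlgType R) : Prop :=
  forall z : A, (forall x, z * x = x * z) -> exists a : R[i], z = a%:A.

Definition projection (R : realType) (A : starAlgType R) (p : A) : Prop :=
  star p = p /\ p * p = p.

(* [p] is abelian when the corner [p A p] is commutative. *)
Definition abelian_projection (R : realType) (A : starAlgType R) (p : A) :=
  projection p /\
  forall x y, (p * x * p) * (p * y * p) = (p * y * p) * (p * x * p).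

(* A factor that is finite (every isometry in it is unitary) and of type II (it
   has no nonzero abelian projection). *)
Definition II1_factor (R : realType) (A : starAlgType R) : Prop :=
  [/\ is_factor A,
      forall v : A, star v * v = 1 -> v * star v = 1 &
      forall p : A, abelian_projection p -> p = 0].

(* Main.v *)
From HB Require Import structures.
Require Import Defs.
From mathcomp Require Import all_boot all_order fingroup perm all_algebra.
From mathcomp Require Import all_classical all_reals all_analysis.
From mathcomp Require Import ring lra.
From mathcomp.real_closed Require Import complex.

Set Implicit Arguments.
Unset Strict Implicit.
Unset Printing Implicit Defensive.

Import Order.TTheory GRing.Theory Num.Theory.
Import numFieldNormedType.Exports.

Local Open Scope classical_set_scope.
Local Open Scope ring_scope.
Local Open Scope complex_scope.

(** Let [j : M -> M_n(M)] send [x] to the diagonal matrix with entries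
    [x, f x, ..., f^(n-1) x]. It is an embedding, and conjugating [j (f x)] by
    the cyclic permutation matrix [c] moves the entries [f x, f^2 x, ...] one
    place down the diagonal, to where [j x] has them; only the first entry is
    wrong. The trace of [M_n(M)] gives weight [1/n] to that entry, so
    [c * j (f x) * star c - j x] has squared 2-norm at most [4/n] times that of
    [x] ([orbit_diag_shift]). Thus [f] becomes almost inner in the extension [j]
    of [M] as [n] grows. Implementing [f] exactly would take a crossed product
    or an HNN extension; an approximate implementation only takes matrices
    ([amplification]).

    Since [M] is existentially closed, an embedding [g] of [M_n(M)] in an
    ultrapower of [M] turns [g \o j] into the diagonal embedding. If [g c] is
    represented by a family of unitaries [v_i] of [M], then for most [i] the
    unitary [v_i] conjugates [f x] close to [x] for finitely many given [x].

    Unitaries have to be lifted from the ultrapower to [M]. A rotation is a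
    product of two reflections, so up to sign [c] is a product of two elements
    [k] with [star k = - k] and [k * k = -1]. Such a [k] has skew-adjoint
    representatives [k_i] in [M], and the Cayley transform
    [w_i = (1 + k_i) (1 - k_i)^-1] is a unitary with
    [w_i - k_i = (1 + k_i^2) (1 - k_i)^-1], which is small in 2-norm because
    [1 - k_i] has an inverse of norm at most [1] ([cayley_transform],
    [lift_complex_structure]). *)

(** * Inverses and the Cayley transform in a von Neumann algebra *)

Lemma CauchySchwarz_dot (C : numClosedFieldType) (V : lmodType C)
    (form : {dot V for Num.conj}) (u v : V) :
  `|form u v| ^+ 2 <= form u u * form v v.
Proof.
have [->|v_neq0] := eqVneq v 0.
  by rewrite !linear0r normr0 expr0n ?mulr0.
have v_gt0 : 0 < form v v by rewrite dnorm_gt0.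
set d := form u v; set b := form v v.
have E : form (b *: u) (d *: v) = b * `|d| ^+ 2.
  by rewrite linearZl_LR linearZr_LR /= -/d -normCKC.
have bE : Num.conj (b * `|d| ^+ 2) = b * `|d| ^+ 2.
  by rewrite geC0_conj// mulr_ge0 ?exprn_ge0// dnorm_ge0.
have := dnorm_ge0 form (b *: u - d *: v).
rewrite dnormB !dnormZ E bE [`|b|]ger0_norm ?dnorm_ge0// -/b => h.
rewrite -subr_ge0 -(pmulr_rge0 _ v_gt0) -/b.
by move: h; congr (0 <= _); ring.
Qed.

Section BoundedOperators.
Variables (R : realType) (M : tracialVNA R).
Local Notation H := (vna_space M).
Implicit Types (x y k : M) (xi eta : H).

Lemma hdot_norm_le xi eta : `|hdot H xi eta| <= `|xi| * `|eta|.
Proof.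
rewrite -(@ler_pXn2r _ 2) ?nnegrE ?mulr_ge0//.
by rewrite exprMn !hdot_norm; exact: CauchySchwarz_dot.
Qed.

(** This is how elements of the algebra are produced by approximation: the
    pointwise limit of a norm-bounded sequence of operators is bounded, and it
    lies in the weak closure by the Cauchy-Schwarz inequality. *)
Lemma strong_limit (x : nat -> M) (c : R[i]) :
  (forall n, op_bound (vna_act (x n)) c) ->
  (forall xi, cvgn (fun n => vna_act (x n) xi)) ->
  exists y, forall xi, (fun n => vna_act (x n) xi) @ \oo --> vna_act y xi.
Proof.
move=> xc xcvg.
pose T xi := limn (fun n => vna_act (x n) xi).
have Tlin : linear T.
  move=> a xi eta; apply: cvg_lim => //.
  under eq_fun do rewrite linearP.
  by apply: cvgD => //; apply: cvgZl_tmp.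
pose T' : {linear H -> H} :=
  HB.pack T (GRing.isLinear.Build _ _ _ _ T Tlin).
have Tb : bounded_op T'.
  exists c; split=> [|xi]; first by case: (xc 0%N).
  apply/ler_addgt0Pr => e e0.
  have /cvgrPdist_lt/(_ e e0)[N _ /(_ N (leqnn N)) /ltW xN] := xcvg xi.
  rewrite -[T' xi](subrK (vna_act (x N) xi)) (le_trans (ler_normD _ _))//.
  by rewrite addrC lerD// (xc N).2.
case: (@act_wot_closed _ M T' Tb) => [n xi eta e e0|y yT]; last first.
  by exists y => xi; rewrite yT; exact: xcvg.
have : \forall m \near \oo, forall k : 'I_n,
    `|hdot H (T (xi k) - vna_act (x m) (xi k)) (eta k)| < e.
  apply: filter_forall => k.
  have d0 : 0 < e / (`|eta k| + 1) by rewrite divr_gt0// ltr_wpDl.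
  have /cvgrPdist_lt/(_ _ d0) := xcvg (xi k); apply: filterS => m.
  rewrite ltr_pdivlMr ?ltr_wpDl//; apply: le_lt_trans.
  by rewrite (le_trans (hdot_norm_le _ _))// ler_wpM2l// lerDl.
case=> m _ /(_ m (leqnn m)) xm.
by exists (vna_act (x m)); first exists (x m).
Qed.

Lemma op_boundX k c n :
  op_bound (vna_act k) c -> op_bound (vna_act (k ^+ n)) (c ^+ n).
Proof.
move=> kc; elim: n => [|n IHn]; first exact: op_bound1.
by rewrite !exprS; exact: op_boundM.
Qed.

Lemma op_bound_sumX k (q : R) n : 0 <= q < 1 -> op_bound (vna_act k) q%:C ->
  op_bound (vna_act (\sum_(i < n) k ^+ i)) ((1 - q)^-1)%:C.
Proof.
move=> /andP[q0 q1] kq.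
have : op_bound (vna_act (\sum_(i < n) k ^+ i)) (\sum_(i < n) q%:C ^+ i).
  elim: n => [|n IHn]; first by rewrite !big_ord0; exact: op_bound0.
  by rewrite !big_ord_recr /=; apply: op_boundD => //; exact: op_boundX.
case=> _ kb; split=> [|xi]; first by rewrite ler0c invr_ge0 subr_ge0 ltW.
rewrite (le_trans (kb xi))// ler_wpM2r//.
have -> : \sum_(i < n) q%:C ^+ i = (\sum_(i < n) q ^+ i)%:C.
  by rewrite rmorph_sum; under [RHS]eq_bigr do rewrite rmorphXn.
rewrite lecR -[(1 - q)^-1]mul1r ler_pdivlMr ?subr_gt0// mulrC.
by rewrite -opprB mulNr -subrX1 opprB gerBl exprn_ge0.
Qed.

(** The inverse is the strong limit of the partial sums of the geometric
    series, which is Cauchy at every vector since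
    [s (m + n) = s m + k ^+ m * s n]. *)
Lemma neumann_inverse k (q : R) : 0 <= q < 1 -> op_bound (vna_act k) q%:C ->
  exists r, r * (1 - k) = 1 /\ (1 - k) * r = 1.
Proof.
move=> q01 kq; have /andP[q0 q1] := q01; pose s n := \sum_(i < n) k ^+ i.
have sb n : op_bound (vna_act (s n)) ((1 - q)^-1)%:C by exact: op_bound_sumX.
have sD m n : s (m + n)%N = s m + k ^+ m * s n.
  rewrite /s big_split_ord; congr (_ + _); rewrite mulr_sumr.
  by apply: eq_bigr => i _; rewrite exprD.
have small c (e : R[i]) : 0 <= c -> 0 < e ->
    \forall n \near \oo, (q ^+ n)%:C * c < e.
  case: c e => [c c'] [e e']; rewrite lecE ltcE /= => /andP[/eqP-> c0].
  move=> /andP[/eqP-> e0].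
  have e1 : 0 < e / (c + 1) by rewrite divr_gt0// ltr_wpDl.
  have /cvg_expr/cvgrPdist_lt/(_ _ e1) : `|q| < 1 by rewrite ger0_norm.
  apply: filterS => n; rewrite sub0r normrN ger0_norm ?exprn_ge0//.
  rewrite ltr_pdivlMr ?ltr_wpDl// => qe.
  rewrite -[c +i* 0]/(c%:C) -[e +i* 0]/(e%:C) -rmorphM ltcR.
  by apply: le_lt_trans qe; rewrite ler_wpM2l ?exprn_ge0// lerDl.
have scvg xi : cvgn (fun n => vna_act (s n) xi).
  apply/cauchy_cvgP/cauchy_exP => e e0.
  have c0 : 0 <= ((1 - q)^-1)%:C * `|xi| by rewrite mulr_ge0//; case: (sb 0%N).
  have [N _ qN] := small _ e c0 e0.
  exists (vna_act (s N) xi); exists N => // n /= Nn.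
  rewrite -ball_normE /= -(subnKC Nn) sD actD opprD addNKr normrN actM.
  apply: le_lt_trans (qN N (leqnn N)).
  have [_ /(_ (vna_act (s (n - N)%N) xi))] := op_boundX N kq.
  move/le_trans; apply; rewrite rmorphXn ler_wpM2l ?exprn_ge0 ?ler0c//.
  exact: (sb _).2.
have [r rP] := strong_limit sb scvg.
have kX0 xi : (fun n => vna_act (1 - k ^+ n) xi) @ \oo --> xi.
  apply/cvgrPdist_lt => e e0; have := small _ e (normr_ge0 xi) e0.
  apply: filterS => n; apply: le_lt_trans.
  rewrite actD actN act1 opprB addrC subrK rmorphXn.
  by have [_ ->] := op_boundX n kq.
have sl n : s n * (1 - k) = 1 - k ^+ n.
  apply: (@oppr_inj M); rewrite opprB subrX1 -mulrN opprB /s.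
  rewrite mulr_suml mulr_sumr.
  by apply: eq_bigr => i _; rewrite mulrBl mulrBr mulr1 mul1r -exprS -exprSr.
have sr n : (1 - k) * s n = 1 - k ^+ n.
  by apply: (@oppr_inj M); rewrite opprB subrX1 -mulNr opprB.
exists r; split; apply/eqP; rewrite -subr_eq0; apply/eqP/act_inj => xi;
  rewrite actD actN act1; apply/eqP; rewrite subr_eq0; apply/eqP.
- rewrite actM; apply: (cvg_unique _ (rP _)) => //.
  have -> : (fun n => vna_act (s n) (vna_act (1 - k) xi)) =
      (fun n => vna_act (1 - k ^+ n) xi).
    by apply/funext => n; rewrite -actM sl.
  exact: kX0.
- have rk : (fun n => vna_act (s n) xi - vna_act k (vna_act (s n) xi)) @ \oo -->
      vna_act ((1 - k) * r) xi.
    rewrite actM actD act1 actN; apply: cvgB => //.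
    apply/cvgrPdist_lt => e e0.
    have /cvgrPdist_lt/(_ e e0) := rP xi; apply: filterS => n.
    apply: le_lt_trans; rewrite -linearB /=.
    rewrite (le_trans (kq.2 _))// ler_piMl// lecR ltW//.
  apply: (cvg_unique _ rk) => //.
  have -> : (fun n => vna_act (s n) xi - vna_act k (vna_act (s n) xi)) =
      (fun n => vna_act (1 - k ^+ n) xi).
    by apply/funext => n; rewrite -sr mulrBl mul1r actD actN actM.
  exact: kX0.
Qed.

(** The cross terms cancel because [<xi, k xi>] is purely imaginary when [k] is
    skew-adjoint. *)
Lemma norm_skew k (a b : R) xi : star k = - k ->
  `|a%:C *: xi + b%:C *: vna_act k xi| ^+ 2 =
  (a ^+ 2)%:C * `|xi| ^+ 2 + (b ^+ 2)%:C * `|vna_act k xi| ^+ 2.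
Proof.
move=> kN; set d := hdot H xi (vna_act k xi).
have dN : Num.conj d = - d.
  have : hdot H (vna_act k xi) xi = - d by rewrite hdot_star kN actN linearNr.
  by rewrite (hermC (hdot H)) expr0 mul1r.
have E : hdot H (a%:C *: xi) (b%:C *: vna_act k xi) = (a * b)%:C * d.
  rewrite linearZl_LR linearZr_LR /= -/d mulrA rmorphM; congr (_ * _ * _).
  exact: conjc_real.
have absC (c : R) : `|c%:C| ^+ 2 = (c ^+ 2)%:C.
  by rewrite -normrX ger0_norm -rmorphXn// ler0c sqr_ge0.
rewrite !hdot_norm dnormD !dnormZ E !absC [Num.conj _]rmorphM /= dN.
by rewrite [_^*%R]conjc_real mulrN subrr addr0.
Qed.

(** With [c] a bound for [k] and [a = 1 / (1 + c^2)], one has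
    [a (1 - k) = 1 - t] for [t = (1 - a) + a k], and by [norm_skew] the squared
    norm of [t] is at most [(1 - a)^2 + a^2 c^2 = 1 - a < 1]: the Neumann series
    of [t] converges although [k] may have large norm. The same identity gives
    [|(1 - k) xi| >= |xi|], hence the bound on the inverse. *)
Lemma skew_resolvent k : star k = - k ->
  exists r, [/\ r * (1 - k) = 1, (1 - k) * r = 1 & op_bound (vna_act r) 1].
Proof.
move=> kN; have [c0 /op_boundR[c kc]] := act_bounded k.
have c1 : 0 < 1 + c ^+ 2 by rewrite ltr_pwDl// sqr_ge0.
pose a := (1 + c ^+ 2)^-1; pose t := (1 - a)%:C%:A + a%:C *: k.
have a0 : 0 < a by rewrite invr_gt0.
have acE : a * c ^+ 2 = 1 - a by rewrite /a; field; rewrite gt_eqF.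
have tq : op_bound (vna_act t) (Num.sqrt (1 - a))%:C.
  have q0 : 0 <= 1 - a by rewrite -acE mulr_ge0 ?sqr_ge0// ltW.
  split=> [|xi]; first by rewrite ler0c sqrtr_ge0.
  rewrite -(@ler_pXn2r _ 2) ?nnegrE ?mulr_ge0 ?ler0c ?sqrtr_ge0//.
  rewrite exprMn -[X in _ <= X * _]rmorphXn /= sqr_sqrtr//.
  rewrite actD !actZ act1 norm_skew//.
  have -> : (1 - a)%:C = ((1 - a) ^+ 2)%:C + (a ^+ 2)%:C * (c ^+ 2)%:C :> R[i].
    rewrite -rmorphM -rmorphD; congr (_%:C).
    by rewrite -[a ^+ 2]/(a * a) -mulrA acE; ring.
  rewrite mulrDl lerD2l -mulrA ler_wpM2l ?ler0c ?sqr_ge0//.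
  rewrite rmorphXn -exprMn lerXn2r ?nnegrE// ?(kc.2)//.
  by rewrite mulr_ge0//; case: kc.
have q01 : 0 <= Num.sqrt (1 - a) < 1.
  by rewrite sqrtr_ge0 -[ltRHS]sqrtr1 ltr_sqrt// gtrBl.
have [r []] := neumann_inverse q01 tq.
have -> : 1 - t = a%:C *: (1 - k).
  rewrite /t rmorphB /= scalerBl scale1r scalerBr opprD opprB addrA.
  by rewrite addrCA subrr addr0.
rewrite -scalerAr -scalerAl => r1 r2; exists (a%:C *: r).
rewrite -scalerAl -scalerAr; split=> //; split=> // xi; rewrite mul1r.
rewrite -(@ler_pXn2r _ 2) ?nnegrE//; set eta := vna_act _ xi.
have -> : xi = eta - vna_act k eta.
  rewrite -[X in _ = X - _]act1 -actN -actD -actM -scalerAr.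
  by rewrite r2 act1.
have := norm_skew 1 (-1) eta kN; rewrite !scale1r rmorphN scaleN1r => ->.
by rewrite sqrrN !expr1n !mul1r lerDl exprn_ge0.
Qed.

(** The unitary is [(1 + k) r] with [r] the inverse of [1 - k], and it differs
    from [k] by [(1 + k * k) * r], where [r] is a contraction. Hence, in 2-norm,
    a skew-adjoint element that is almost unitary is close to a unitary. *)
Lemma cayley_transform k : star k = - k ->
  exists2 w, unitary w & norm2sq (w - k) <= norm2sq (1 + k * k).
Proof.
move=> kN; have [r [rk kr rb]] := skew_resolvent kN.
have starB1 : star (1 - k) = 1 + k by rewrite starB star1 kN opprK.
have starD1 : star (1 + k) = 1 - k by rewrite starD star1 kN.
have rk' : star r * (1 + k) = 1 by rewrite -starB1 -starM kr star1.
have kr' : (1 + k) * star r = 1 by rewrite -starB1 -starM rk star1.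
have kC : (1 - k) * (1 + k) = (1 + k) * (1 - k).
  rewrite mulrBl mulrDl !mul1r mulrDr mulrBr !mulr1 opprD !addrA.
  by rewrite addrK subrK.
have rC : (1 + k) * r = r * (1 + k).
  have : r * ((1 + k) * (1 - k)) * r = (1 + k) * r.
    by rewrite -kC [r * _]mulrA rk mul1r.
  by rewrite mulrA -mulrA kr mulr1.
exists ((1 + k) * r).
  split; rewrite starM starD1.
    by rewrite mulrA -[star r * _ * _]mulrA kC mulrA rk' mul1r.
  by rewrite rC mulrA -[r * _ * _]mulrA kr' mulr1.
have -> : (1 + k) * r - k = (1 + k * k) * r.
  have kE : k = k * (1 - k) * r by rewrite -mulrA kr mulr1.
  rewrite [X in _ - X]kE -mulrBl; congr (_ * _).
  by rewrite mulrBr mulr1 opprB addrA addrAC addrK.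
rewrite -norm2sq_star starM (le_trans (norm2sqM_bound _ (op_bound_star rb)))//.
by rewrite expr1n mul1r norm2sq_star.
Qed.

End BoundedOperators.

(** * Finite direct sums of a Hilbert space *)

Section DirectSum.
Variables (R : realType) (H : hilbertSpace R) (n : nat).

(** Neither functions nor row vectors serve here: they come with the product
    topology or the sup norm, whereas the norm has to be the l^2 norm. *)
Definition dsum : Type := {ffun 'I_n -> H}.
HB.instance Definition _ := GRing.Lmodule.on dsum.
Implicit Types u v : dsum.

Definition dsum_dot u v : R[i] := \sum_i hdot H (u i) (v i).

Lemma dsum_dot_bilinear : bilinear_for
  (GRing.Scale.Law.clone _ _ *%R _)
  (GRing.Scale.Law.clone _ _ (Num.conj \; *%R) _) dsum_dot.
Proof.
split=> [v|u] a x y /=; rewrite /dsum_dot mulr_sumr -big_split /=.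
  by apply: eq_bigr => i _; rewrite !ffunE linearPl.
by apply: eq_bigr => i _; rewrite !ffunE linearPr.
Qed.

HB.instance Definition _ := bilinear_isBilinear.Build R[i] dsum dsum R[i]
  (GRing.Scale.Law.clone _ _ *%R _)
  (GRing.Scale.Law.clone _ _ (Num.conj \; *%R) _) dsum_dot dsum_dot_bilinear.

Lemma dsum_dot_hermitian u v :
  dsum_dot u v = (-1) ^+ false * Num.conj (dsum_dot v u).
Proof.
rewrite expr0 mul1r rmorph_sum; apply: eq_bigr => i _.
by rewrite (hermC (hdot H)) expr0 mul1r.
Qed.

HB.instance Definition _ :=
  @isHermitianSesquilinear.Build R[i] dsum false Num.conj dsum_dot
    dsum_dot_hermitian.

Lemma dsum_dotE u : dsum_dot u u = \sum_i `|u i| ^+ 2.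
Proof. by apply: eq_bigr => i _; rewrite hdot_norm. Qed.

Lemma dsum_dot_ge0 u : 0 <= dsum_dot u u.
Proof. by rewrite dsum_dotE sumr_ge0// => i _; rewrite exprn_ge0. Qed.

Lemma dsum_dot_eq0 u : dsum_dot u u = 0 -> u = 0.
Proof.
rewrite dsum_dotE => /eqP; rewrite psumr_eq0 => [/allP u0|i _]; last first.
  by rewrite exprn_ge0.
apply/ffunP => i; rewrite ffunE.
by have /= := u0 i (mem_index_enum i); rewrite sqrf_eq0 normr_eq0 => /eqP.
Qed.

Lemma dsum_dot_gt0 u : u != 0 -> 0 < dsum_dot u u.
Proof.
rewrite lt_def dsum_dot_ge0 andbT; apply: contraNneq.
by move=> /dsum_dot_eq0 ->.
Qed.

HB.instance Definition _ := @isDotProduct.Build R[i] dsum dsum_dot dsum_dot_gt0.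

Definition dsum_norm u : R[i] := sqrtC (dsum_dot u u).

Lemma dsum_normD u v : dsum_norm (u + v) <= dsum_norm u + dsum_norm v.
Proof.
have n0 w : 0 <= dsum_norm w by rewrite sqrtC_ge0 dsum_dot_ge0.
have nE w : dsum_norm w ^+ 2 = dsum_dot w w by rewrite sqrtCK.
rewrite -(@ler_pXn2r _ 2) ?nnegrE ?addr_ge0// nE.
rewrite sqrrD !nE dnormD addrAC lerD2r lerD2l; set d := dsum_dot u v.
have dR : d + Num.conj d \is Num.real.
  by apply/CrealP; rewrite rmorphD /= conjCK addrC.
rewrite (le_trans (real_ler_norm dR))// (le_trans (ler_normD _ _))//.
rewrite norm_conjC -mulr2n lerMn2r /=.
rewrite -(@ler_pXn2r _ 2) ?nnegrE ?mulr_ge0// exprMn !nE.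
exact: CauchySchwarz_dot.
Qed.

Lemma dsum_normZ (a : R[i]) u : dsum_norm (a *: u) = `|a| * dsum_norm u.
Proof.
by rewrite /dsum_norm dnormZ sqrtCM ?nnegrE ?exprn_ge0 ?dsum_dot_ge0// sqrCK.
Qed.

Lemma dsum_norm_eq0 u : dsum_norm u = 0 -> u = 0.
Proof. by move/eqP; rewrite sqrtC_eq0 => /eqP/dsum_dot_eq0. Qed.

HB.instance Definition _ := Lmodule_isNormed.Build R[i] dsum
  dsum_normD dsum_normZ dsum_norm_eq0.

Lemma dsum_hdot_norm u : `|u| ^+ 2 = dsum_dot u u.
Proof. by rewrite sqrtCK. Qed.

Definition dsum_inj i (xi : H) : dsum := [ffun j => if j == i then xi else 0].

Lemma dsum_injP u : u = \sum_i dsum_inj i (u i).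
Proof.
apply/ffunP => i; rewrite sum_ffunE (bigD1 i)//= ffunE eqxx.
rewrite big1 ?addr0// => j ji.
by rewrite ffunE eq_sym (negbTE ji).
Qed.

Lemma dsum_dot_injl i xi v : dsum_dot (dsum_inj i xi) v = hdot H xi (v i).
Proof.
rewrite /dsum_dot (bigD1 i)//= ffunE eqxx big1 ?addr0// => j ji.
by rewrite ffunE (negbTE ji) linear0l.
Qed.

Lemma dsum_dot_injr i xi v : dsum_dot v (dsum_inj i xi) = hdot H (v i) xi.
Proof.
rewrite /dsum_dot (bigD1 i)//= ffunE eqxx big1 ?addr0// => j ji.
by rewrite ffunE (negbTE ji) linear0r.
Qed.

Lemma norm_dsum_inj i xi : `|dsum_inj i xi| = `|xi|.
Proof.
apply/eqP; rewrite -(@eqrXn2 _ 2)//; apply/eqP.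
by rewrite dsum_hdot_norm dsum_dot_injl ffunE eqxx hdot_norm.
Qed.

Lemma norm_dsum_coord u i : `|u i| <= `|u|.
Proof.
rewrite -(@ler_pXn2r _ 2) ?nnegrE// dsum_hdot_norm dsum_dotE (bigD1 i)//=.
by rewrite lerDl sumr_ge0// => j _; rewrite exprn_ge0.
Qed.

Lemma norm_dsum_le u : `|u| <= \sum_i `|u i|.
Proof.
rewrite {1}[u]dsum_injP (le_trans (ler_norm_sum _ _ _))//.
by apply: ler_sum => i _; rewrite norm_dsum_inj.
Qed.

(** Each coordinate of a Cauchy filter converges since coordinates are
    contractions, and the norm is at most the sum of the norms of the
    coordinates. *)
Lemma dsum_complete (F : set_system dsum) : ProperFilter F -> cauchy F -> cvg F.
Proof.
move=> FF /cauchyP Fc; pose p i (u : dsum) : H := u i.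
have pcvg i : cvg (p i @ F).
  apply/cauchy_cvgP/cauchy_exP => e e0; have [u Fu] := Fc e e0.
  exists (u i); apply: (@filterS _ F _ _ _ _ Fu) => v.
  rewrite /= -!ball_normE /= => uv.
  apply: le_lt_trans uv; rewrite /p.
  by have := norm_dsum_coord (u - v) i; rewrite !ffunE.
apply/cvg_ex; exists ([ffun i => lim (p i @ F)] : dsum).
apply/cvgrPdist_lt => e e0.
have d0 : 0 < e / n.+1%:R by rewrite divr_gt0// ltr0n.
have : \forall u \near F, forall i,
    `|lim (p i @ F) - (u : dsum) i| < e / n.+1%:R.
  apply: filter_forall => i.
  by have /cvgrPdist_lt/(_ _ d0) := pcvg i.
apply: filterS => u up; apply: le_lt_trans (norm_dsum_le _) _.
apply: (@le_lt_trans _ _ (\sum_(i < n) e / n.+1%:R)).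
  by apply: ler_sum => i _; rewrite !ffunE ltW.
rewrite sumr_const card_ord -[_ *+ n]mulr_natr mulrAC -mulrA gtr_pMr//.
by rewrite ltr_pdivrMr ?ltr0n// mul1r ltr_nat.
Qed.

HB.instance Definition _ := Uniform_isComplete.Build dsum dsum_complete.

Definition dsum_hilbert : hilbertSpace R :=
  @HilbertSpace R dsum dsum_dot dsum_hdot_norm.

End DirectSum.

(** * Matrix amplifications *)

Lemma star_sum (R : realType) (A : starAlgType R) (I : finType) (F : I -> A) :
  star (\sum_i F i) = \sum_i star (F i).
Proof.
apply: (big_morph star (@starD R A)).
by have := @starZ R A 0 0; rewrite !scale0r rmorph0 scale0r.
Qed.

Lemma tau_sum (R : realType) (A : tracialAlgType R) (I : finType) (F : I -> A) :
  tau (\sum_i F i) = \sum_i tau (F i).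
Proof. exact: (big_morph _ (@tauD R A) (@tau0 R A)). Qed.

Lemma act_sum (R : realType) (M : tracialVNA R) (I : finType) (F : I -> M) xi :
  vna_act (\sum_i F i) xi = \sum_i vna_act (F i) xi.
Proof.
by apply: (big_morph (fun x => vna_act x xi)) => [x y|];
  [exact: actD|exact: act0].
Qed.

Section Amplification.
Variables (R : realType) (M : tracialVNA R) (n : nat).
Local Notation H := (vna_space M).
Local Notation Hn := (dsum_hilbert H n.+1).

(** An alias, because ['M[M]_n.+1] is already a module over [M], while a
    *-algebra is a module over the complex numbers. *)
Definition amp : Type := 'M[M]_n.+1.
HB.instance Definition _ := GRing.NzRing.on amp.
Implicit Types (X Y Z : amp) (a : R[i]) (u v : Hn).

Definition amp_scale a X : amp := \matrix_(i, j) (a *: X i j).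

Lemma amp_scaleA a b X : amp_scale a (amp_scale b X) = amp_scale (a * b) X.
Proof. by apply/matrixP => i j; rewrite !mxE scalerA. Qed.

Lemma amp_scale1 : left_id 1 amp_scale.
Proof. by move=> X; apply/matrixP => i j; rewrite !mxE scale1r. Qed.

Lemma amp_scaleDr : right_distributive amp_scale +%R.
Proof. by move=> a X Y; apply/matrixP => i j; rewrite !mxE scalerDr. Qed.

Lemma amp_scaleDl X : {morph amp_scale^~ X : a b / a + b}.
Proof. by move=> a b; apply/matrixP => i j; rewrite !mxE scalerDl. Qed.

HB.instance Definition _ := GRing.Zmodule_isLmodule.Build R[i] amp
  amp_scaleA amp_scale1 amp_scaleDr amp_scaleDl.

Lemma amp_scaleE a X i j : (a *: X) i j = a *: X i j.
Proof. by rewrite mxE. Qed.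

Lemma amp_mulE X Y i j : (X * Y) i j = \sum_k X i k * Y k j.
Proof. by rewrite mxE. Qed.

Lemma amp_addE X Y i j : (X + Y) i j = X i j + Y i j.
Proof. by rewrite mxE. Qed.

Lemma amp_scaleAl a X Y : a *: (X * Y) = (a *: X) * Y.
Proof.
apply/matrixP => i j; rewrite amp_scaleE !amp_mulE scaler_sumr.
by apply: eq_bigr => k _; rewrite amp_scaleE scalerAl.
Qed.

HB.instance Definition _ :=
  GRing.Lmodule_isLalgebra.Build R[i] amp amp_scaleAl.

Lemma amp_scaleAr a X Y : a *: (X * Y) = X * (a *: Y).
Proof.
apply/matrixP => i j; rewrite amp_scaleE !amp_mulE scaler_sumr.
by apply: eq_bigr => k _; rewrite amp_scaleE scalerAr.
Qed.

HB.instance Definition _ :=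
  GRing.Lalgebra_isAlgebra.Build R[i] amp amp_scaleAr.

Definition amp_star X : amp := \matrix_(i, j) star (X j i).

Lemma amp_starD X Y : amp_star (X + Y) = amp_star X + amp_star Y.
Proof. by apply/matrixP => i j; rewrite !mxE starD. Qed.

Lemma amp_starZ a X : amp_star (a *: X) = Num.conj a *: amp_star X.
Proof.
by apply/matrixP => i j; rewrite mxE !amp_scaleE starZ mxE.
Qed.

Lemma amp_starM X Y : amp_star (X * Y) = amp_star Y * amp_star X.
Proof.
apply/matrixP => i j; rewrite mxE !amp_mulE star_sum.
by apply: eq_bigr => k _; rewrite starM !mxE.
Qed.

Lemma amp_starK : involutive amp_star.
Proof. by move=> X; apply/matrixP => i j; rewrite !mxE starK. Qed.

HB.instance Definition _ := isStarAlgebra.Build R amp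
  amp_starD amp_starZ amp_starM amp_starK.

Lemma amp_starE X i j : star X i j = star (X j i).
Proof. by rewrite mxE. Qed.

Definition amp_tau X : R[i] := n.+1%:R^-1 * \sum_i tau (X i i).

Lemma amp_tau_linear a X Y :
  amp_tau (a *: X + Y) = a * amp_tau X + amp_tau Y.
Proof.
rewrite /amp_tau [a * _]mulrCA -mulrDr; congr (_ * _).
rewrite mulr_sumr -big_split /=.
by apply: eq_bigr => i _; rewrite amp_addE amp_scaleE tau_linear.
Qed.

Lemma amp_tau1 : amp_tau 1 = 1.
Proof.
rewrite /amp_tau (eq_bigr (fun=> 1)) => [|i _]; last by rewrite mxE eqxx tau1.
by rewrite sumr_const card_ord mulVf// pnatr_eq0.
Qed.

Lemma amp_tauC X Y : amp_tau (X * Y) = amp_tau (Y * X).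
Proof.
rewrite /amp_tau; congr (_ * _).
under eq_bigr do rewrite amp_mulE tau_sum.
rewrite exchange_big /=; apply: eq_bigr => j _.
by rewrite amp_mulE tau_sum; apply: eq_bigr => i _; rewrite tauC.
Qed.

Lemma amp_tau_sq X :
  amp_tau (star X * X) =
  n.+1%:R^-1 * \sum_i \sum_j tau (star (X j i) * X j i).
Proof.
congr (_ * _); apply: eq_bigr => i _; rewrite amp_mulE tau_sum.
by apply: eq_bigr => j _; rewrite amp_starE.
Qed.

Lemma amp_tau_ge0 X : 0 <= amp_tau (star X * X).
Proof.
rewrite amp_tau_sq mulr_ge0 ?invr_ge0 ?ler0n//.
by do 2![apply: sumr_ge0 => ? _]; exact: tau_ge0.
Qed.

Lemma amp_tau_faithful X : amp_tau (star X * X) = 0 -> X = 0.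
Proof.
rewrite amp_tau_sq => /eqP; rewrite mulf_eq0 invr_eq0 pnatr_eq0 /=.
rewrite psumr_eq0 => [/allP X0|i _]; last first.
  by apply: sumr_ge0 => j _; exact: tau_ge0.
apply/matrixP => j i; rewrite mxE; apply: tau_faithful; apply/eqP.
have /= := X0 i (mem_index_enum i).
rewrite psumr_eq0 => [/allP/(_ j (mem_index_enum j))//|k _]; exact: tau_ge0.
Qed.

HB.instance Definition _ := isTracial.Build R amp
  amp_tau_linear amp_tau1 amp_tau_ge0 amp_tauC amp_tau_faithful.

Definition amp_act X u : Hn := [ffun i => \sum_j vna_act (X i j) (u j)].

Lemma amp_act_linear X : linear (amp_act X).
Proof.
move=> a u v; apply/ffunP => i; rewrite !ffunE scaler_sumr -big_split /=.
by apply: eq_bigr => j _; rewrite !ffunE linearP.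
Qed.

HB.instance Definition _ X :=
  GRing.isLinear.Build R[i] Hn Hn _ (amp_act X) (amp_act_linear X).

Lemma amp_actE X u i : amp_act X u i = \sum_j vna_act (X i j) (u j).
Proof. by rewrite ffunE. Qed.

Lemma amp_act_inj X i j xi : amp_act X (dsum_inj j xi) i = vna_act (X i j) xi.
Proof.
rewrite amp_actE (bigD1 j)//= ffunE eqxx big1 ?addr0// => k kj.
by rewrite ffunE (negbTE kj) linear0.
Qed.

Lemma amp_act_lin a X Y u :
  amp_act (a *: X + Y) u = a *: amp_act X u + amp_act Y u.
Proof.
apply/ffunP => i; rewrite !ffunE scaler_sumr -big_split /=.
by apply: eq_bigr => j _; rewrite amp_addE amp_scaleE act_linear.
Qed.

Lemma amp_act1 u : amp_act 1 u = u.
Proof.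
apply/ffunP => i; rewrite ffunE (bigD1 i)//= mxE eqxx act1.
rewrite big1 ?addr0// => j ji.
by rewrite mxE eq_sym (negbTE ji) act0.
Qed.

Lemma amp_actM X Y u : amp_act (X * Y) u = amp_act X (amp_act Y u).
Proof.
apply/ffunP => i; rewrite !ffunE.
under eq_bigr do rewrite amp_mulE act_sum.
rewrite exchange_big /=; apply: eq_bigr => k _.
by rewrite ffunE linear_sum; apply: eq_bigr => j _; rewrite actM.
Qed.

Lemma amp_act_star X u v :
  hdot Hn (amp_act (star X) u) v = hdot Hn u (amp_act X v).
Proof.
transitivity (\sum_i \sum_j hdot H (vna_act (star (X j i)) (u j)) (v i)).
  apply: eq_bigr => i _; rewrite amp_actE linear_sumlz.
  by apply: eq_bigr => j _; rewrite amp_starE.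
rewrite exchange_big; apply: eq_bigr => j _ /=.
by rewrite amp_actE linear_sumr; apply: eq_bigr => i _; rewrite act_star.
Qed.

Lemma amp_act_bounded X : bounded_op (amp_act X).
Proof.
pose c i j := projT1 (cid (act_bounded (X i j))).
have cP i j : op_bound (vna_act (X i j)) (c i j) by exact: projT2 (cid _).
exists (\sum_i \sum_j c i j); split=> [|u].
  by do 2![apply: sumr_ge0 => ? _]; exact: (cP _ _).1.
rewrite (le_trans (norm_dsum_le _))// mulr_suml; apply: ler_sum => i _.
rewrite amp_actE (le_trans (ler_norm_sum _ _ _))// mulr_suml.
apply: ler_sum => j _; have [c0 cb] := cP i j.
by rewrite (le_trans (cb _))// ler_wpM2l//; exact: norm_dsum_coord.
Qed.

Lemma amp_act_eq0 X : (forall u, amp_act X u = 0) -> X = 0.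
Proof.
move=> X0; apply/matrixP => i j; rewrite mxE; apply: act_inj => xi.
by rewrite -amp_act_inj X0 ffunE.
Qed.

(** The matrix entries of an operator in the weak closure are in the weak
    closure of the action of [M], because the matrix coefficients of the
    [(i, j)] entry are matrix coefficients of the whole operator at vectors
    supported at [j] and [i]. *)
Lemma amp_act_wot_closed (T : {linear Hn -> Hn}) : bounded_op T ->
  wot_closure (range (fun X => amp_act X : Hn -> Hn)) T ->
  exists X, amp_act X =1 T.
Proof.
move=> [c [c0 Tc]] Tcl.
have entry i j : exists x : M, forall xi, vna_act x xi = T (dsum_inj j xi) i.
  pose S xi : H := T (dsum_inj j xi) i.
  have Slin : linear S.
    move=> a xi eta; rewrite /S.
    have -> : dsum_inj j (a *: xi + eta) =
        a *: (dsum_inj j xi : Hn) + dsum_inj j eta.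
      by apply/ffunP => k; rewrite !ffunE; case: ifP; rewrite ?scaler0 ?addr0.
    by rewrite linearP !ffunE.
  pose S' : {linear H -> H} :=
    HB.pack S (GRing.isLinear.Build _ _ _ _ S Slin).
  apply: (@act_wot_closed _ M S').
    exists c; split=> // xi; rewrite -(norm_dsum_inj j xi).
    by rewrite (le_trans (norm_dsum_coord _ _))// Tc.
  move=> m xi eta e e0.
  have [_ [X _ <-] XT] := Tcl m (fun k => dsum_inj j (xi k))
    (fun k => dsum_inj i (eta k)) e e0.
  exists (vna_act (X i j)) => [|k]; first by exists (X i j).
  have := XT k; rewrite [hdot _ _ _]dsum_dot_injr.
  by rewrite !ffunE -amp_act_inj ffunE.
pose x i j := projT1 (cid (entry i j)).
have xP i j xi : vna_act (x i j) xi = T (dsum_inj j xi) i.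
  exact: (projT2 (cid (entry i j))).
exists (\matrix_(i, j) x i j) => u; apply/ffunP => i.
rewrite [u in RHS]dsum_injP linear_sum sum_ffunE amp_actE.
by apply: eq_bigr => j _; rewrite mxE xP.
Qed.

Lemma amp_tau_positive X :
  (forall u, 0 <= hdot Hn (amp_act X u) u) -> 0 <= amp_tau X.
Proof.
move=> X0; rewrite mulr_ge0 ?invr_ge0 ?ler0n// sumr_ge0// => i _.
apply: tau_positive => xi; have := X0 (dsum_inj i xi).
by rewrite [hdot _ _ _]dsum_dot_injr amp_act_inj.
Qed.

(** The forms that control [tau] on [M] are placed at each of the [n + 1]
    diagonal entries, whence the index set ['I_n.+1 * 'I_m]. *)
Lemma amp_tau_normal (e : R[i]) : 0 < e ->
  exists m (xi eta : 'I_m -> nat -> Hn) (d : R[i]),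
    [/\ 0 < d,
        forall k, square_summable (xi k) /\ square_summable (eta k) &
        forall X,
          (forall k, `|ultraweak_form (xi k) (eta k) (amp_act X)| < d) ->
          `|amp_tau X| < e].
Proof.
move=> e0; have e20 : 0 < e / 2 by rewrite divr_gt0.
have [m [xi [eta [d [d0 ss dP]]]]] := tau_normal M e20.
pose J : finType := ('I_n.+1 * 'I_m)%type.
pose lift (zeta : 'I_m -> nat -> H) (k : 'I_#|J|) (l : nat) : Hn :=
  dsum_inj (enum_val k).1 (zeta (enum_val k).2 l).
have lift_ss zeta k : square_summable (zeta (enum_val k).2) ->
    square_summable (lift zeta k).
  case=> c zc; exists c => N; apply: le_trans (zc N).
  by apply: ler_sum => l _; rewrite norm_dsum_inj.
exists #|J|, (lift xi), (lift eta), d; split=> // [k|X Xd].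
  by have [? ?] := ss (enum_val k).2; split; exact: lift_ss.
have Xe i : `|tau (X i i)| < e / 2.
  apply: dP => k; have := Xd (enum_rank (i, k)).
  rewrite /ultraweak_form (_ : (fun l => _) =
    (fun l => hdot H (vna_act (X i i) (xi k l)) (eta k l)))//.
  apply/funext => l; rewrite [LHS]dsum_dot_injr amp_act_inj.
  by rewrite /= enum_rankK.
rewrite normrM ger0_norm ?invr_ge0 ?ler0n// ltr_pdivrMl ?ltr0n//.
rewrite (le_lt_trans (ler_norm_sum _ _ _))//.
apply: (@le_lt_trans _ _ (\sum_(i < n.+1) e / 2)).
  by apply: ler_sum => i _; exact: ltW.
rewrite sumr_const card_ord -[_ *+ n.+1]mulr_natl ltr_pM2l ?ltr0n//.
by rewrite ltr_pdivrMr// ltr_pMr// ltr1n.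
Qed.

Definition amplification : tracialVNA R :=
  @TracialVNA R amp Hn (fun X => amp_act X : {linear Hn -> Hn})
    amp_act_lin amp_act1 amp_actM amp_act_star amp_act_bounded amp_act_eq0
    amp_act_wot_closed amp_tau_positive amp_tau_normal.

End Amplification.

(** * Lifting unitaries from the ultrapower *)

Section UnitaryLifting.
Variables (R : realType) (M : tracialVNA R).

Lemma op_bound_unitary (w : M) : unitary w -> op_bound (vna_act w) 1.
Proof.
case=> ww _; split=> // xi; rewrite mul1r -(@ler_pXn2r _ 2) ?nnegrE//.
by rewrite !hdot_norm hdot_star -actM ww act1.
Qed.

Variables (I : Type) (U : ultrafilterOn I).
Local Notation cls := (ultra_class U).
Implicit Types x y : linfty M I.

Lemma ultra_classB x y : cls (x - y) = cls x - cls y.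
Proof. by apply/eqP; rewrite eq_sym subr_eq -ultra_classD subrK. Qed.

Lemma ultra_classM x y : cls (linfty_mul x y) = cls x * cls y.
Proof. by rewrite -ultra_mulE. Qed.

Lemma ultra_class_star x : cls (linfty_star x) = star (cls x).
Proof. by rewrite -ultra_starE. Qed.

Lemma ultra_classZ a x : cls (linfty_scale a x) = a *: cls x.
Proof. by rewrite -ultra_scaleE. Qed.

Lemma cvg_norm2sq_class x :
  (fun i => norm2sq (x i)) @ ultra_set U --> norm2sq (cls x).
Proof.
have [+ _] := linfty_tauP U (linfty_mul (linfty_star x) x).
by rewrite /norm2sq -ultra_class_star -ultra_classM [tau _]ultra_tauE.
Qed.

(** A representative can be made skew-adjoint at every index by averaging, and
    its values are then replaced by unitaries through [cayley_transform]; the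
    change tends to [0] in 2-norm since [1 + k * k = 0]. *)
Lemma lift_complex_structure (k : ultrapower M U) :
  star k = - k -> k * k = -1 ->
  exists w : linfty M I, (forall i, unitary (w i)) /\ cls w = k.
Proof.
elim/ultra_ind: k => a aN a2.
pose h := linfty_scale 2^-1 (a - linfty_star a).
have hk : cls h = cls a.
  rewrite ultra_classZ ultra_classB ultra_class_star aN opprK.
  have -> : cls a + cls a = 2 *: cls a by rewrite scaler_nat mulr2n.
  by rewrite scalerA mulVf ?scale1r// pnatr_eq0.
have hN i : star (h i) = - h i.
  rewrite /= starZ starB starK -scalerN opprB; congr (_ *: _).
  by rewrite geC0_conj// invr_ge0 ler0n.
pose w i := s2val (cid2 (cayley_transform (hN i))).
have wu i : unitary (w i) by exact: (s2valP (cid2 (cayley_transform (hN i)))).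
have wh i : norm2sq (w i - h i) <= norm2sq (1 + h i * h i).
  exact: (s2valP' (cid2 (cayley_transform (hN i)))).
have wb : w \in @bounded_family R M I.
  by apply: (@linfty_mk _ _ _ _ 1) => i; exact: op_bound_unitary.
exists (Linfty wb); split=> //; rewrite -hk; apply/ultra_classP.
apply: (@null_family_le _ _ _ _ _
  (fun i => norm2sq (1 + h i * h i))) => //.
have := @cvg_norm2sq_class (linfty_cst _ 1 + linfty_mul h h).
rewrite ultra_classD ultra_classM hk a2.
rewrite -[cls (linfty_cst _ _)]/(1 : ultrapower M U) subrr norm2sq0.
exact.
Qed.
End UnitaryLifting.

(** * Almost implementing an endomorphism by a permutation matrix *)

Section ShiftMatrices.
Variables (R : realType) (M : tracialVNA R).

Lemma embedding_iter (A : tracialAlgType R) (f : A -> A) n :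
  embedding f -> embedding (iter n f).
Proof.
move=> fe; elim: n => [|n IHn]; first by split.
by split=> *; rewrite /= ?(emb_linear IHn, emb1 IHn, embM IHn, emb_star IHn,
  emb_linear fe, emb1 fe, embM fe, emb_star fe, emb_tau fe, emb_tau IHn).
Qed.

Lemma norm2sq_embedding (A B : tracialAlgType R) (f : A -> B) x :
  embedding f -> norm2sq (f x) = norm2sq x.
Proof.
by move=> fe; rewrite /norm2sq -(emb_star fe) -(embM fe) (emb_tau fe).
Qed.

Variable n : nat.
Local Notation Mn := (amplification M n).
Implicit Types (X : Mn) (s : {perm 'I_n.+1}).

Lemma norm2sq_amp X :
  norm2sq X = n.+1%:R^-1 * \sum_i \sum_j norm2sq (X j i).
Proof.
apply: (@complexI R); rewrite -tau_sqE [LHS]amp_tau_sq.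
rewrite rmorphM rmorphV ?unitfE//=.
rewrite rmorph_nat; congr (_ * _); rewrite rmorph_sum; apply: eq_bigr => i _.
by rewrite rmorph_sum; apply: eq_bigr => j _; rewrite tau_sqE.
Qed.

Definition orbit_diag (f : M -> M) (x : M) : Mn :=
  \matrix_(i, j) if i == j then iter i f x else 0.

Lemma orbit_diag_embedding f : embedding f -> embedding (orbit_diag f).
Proof.
move=> fe; have fi i := embedding_iter i fe.
split=> [a x y||x y|x|x].
- apply/matrixP => i j; rewrite amp_addE amp_scaleE !mxE.
  by case: eqP => _; rewrite ?(emb_linear (fi _))// scaler0 addr0.
- by apply/matrixP => i j; rewrite !mxE (emb1 (fi _)); case: eqP.
- apply/matrixP => i j; rewrite amp_mulE mxE (bigD1 i)//= !mxE eqxx.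
  rewrite big1 => [|k ki]; last by rewrite mxE eq_sym (negbTE ki) mul0r.
  by rewrite addr0; case: eqP => _; rewrite ?mulr0// (embM (fi _)).
- apply/matrixP => i j; rewrite amp_starE !mxE eq_sym.
  by case: eqP => [->|_]; rewrite ?(emb_star (fi _))// Defs.star0.
- rewrite -[LHS]/(amp_tau _) /amp_tau (eq_bigr (fun=> tau x)) => [|i _].
    by rewrite sumr_const card_ord -[tau x *+ _]mulr_natl mulKf// pnatr_eq0.
  by rewrite mxE eqxx (emb_tau (fi _)).
Qed.

Definition perm_amp s : Mn := perm_mx s.

Lemma perm_ampM s t : perm_amp (s * t)%g = perm_amp s * perm_amp t.
Proof. exact: perm_mxM. Qed.

Lemma star_perm_amp s : star (perm_amp s) = perm_amp s^-1%g.
Proof.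
rewrite /perm_amp -tr_perm_mx; apply/matrixP => i j; rewrite amp_starE !mxE.
by case: eqP => _; rewrite ?star1 ?Defs.star0.
Qed.

Lemma perm_amp_conj s X i j :
  (perm_amp s * X * star (perm_amp s)) i j = X (s i) (s j).
Proof.
rewrite star_perm_amp -[perm_amp s * X]/(perm_mx s *m X) -row_permE.
by rewrite -[_ * perm_amp _]/(_ *m perm_mx _) -col_permE !mxE.
Qed.

(** The two involutions are the reflections [i |-> - i] modulo [n + 1] and
    [i |-> n - i], whose composite is the rotation [i |-> i - 1]. After
    conjugation the entry at [i > 0] is [f^(i-1) (f x) = f^i x], and the
    difference is supported at the entry [(0, 0)], where it is
    [f^(n+1) x - x]. *)
Lemma orbit_diag_shift (f : M -> M) : embedding f ->
  exists s t : {perm 'I_n.+1}, [/\ (s * s)%g = 1%g, (t * t)%g = 1%g &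
    forall x, norm2sq (perm_amp s * perm_amp t * orbit_diag f (f x) *
        star (perm_amp s * perm_amp t) - orbit_diag f x) <=
      n.+1%:R^-1 * (4 * norm2sq x)].
Proof.
move=> fe.
pose s := perm (inv_inj (@opprK 'I_n.+1)); pose t := perm (@rev_ord_inj n.+1).
exists s, t; split=> [||x].
- by apply/permP => i; rewrite permM !permE opprK.
- by apply/permP => i; rewrite permM !permE rev_ordK.
set D := _ - _.
have tsE i : (s * t)%g i = (if i == ord0 then n else i.-1) :> nat.
  rewrite permM !permE /= subSS; case: i => [[|i] /= lt_in] /=.
    by rewrite subn0 modnn subn0.
  rewrite subSS modn_small ?ltnS ?leq_subr// subKn//; exact: ltnW.
have DE i j : D i j = if (i == ord0) && (j == ord0)
    then iter n.+1 f x - x else 0.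
  rewrite amp_addE -perm_ampM perm_amp_conj !mxE (inj_eq perm_inj).
  have [<-|ij] := eqVneq i j; last first.
    rewrite subr0; case: eqP => //= i0; case: eqP => // j0.
    by rewrite i0 j0 eqxx in ij.
  rewrite andbb -iterSr tsE; case: eqP => [->//|/eqP i0].
  rewrite prednK ?subrr// lt0n; apply: contra i0 => /eqP i0.
  by apply/eqP/val_inj.
rewrite norm2sq_amp ler_wpM2l ?invr_ge0// (bigD1 ord0)//= (bigD1 ord0)//=.
rewrite DE eqxx /= big1 => [|j j0]; last by rewrite DE (negbTE j0) norm2sq0.
rewrite big1 => [|i i0]; last first.
  by apply: big1 => j _; rewrite DE (negbTE i0) andbF norm2sq0.
rewrite !addr0 (le_trans (norm2sqD _ _))// norm2sqN -iterS.
rewrite (norm2sq_embedding _ (embedding_iter n.+1 fe)); lra.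
Qed.

(** An involutive permutation matrix is self-adjoint with square [1]; the factor
    ['i] puts it in the form required by [lift_complex_structure] and cancels
    in conjugations. *)
Lemma perm_amp_complex_structure s : (s * s)%g = 1%g ->
  let k : Mn := 'i *: perm_amp s in star k = - k /\ k * k = -1.
Proof.
move=> ss /=; have sV : (s^-1)%g = s by apply: (mulgI s); rewrite mulgV ss.
split; first by rewrite starZ star_perm_amp sV conjCi scaleNr.
rewrite -scalerAl -scalerAr scalerA -perm_ampM ss -expr2 sqrCi scaleN1r.
by rewrite /perm_amp perm_mx1.
Qed.

End ShiftMatrices.

Lemma embeddingB (R : realType) (A B : tracialAlgType R) (g : A -> B) x y :
  embedding g -> g (x - y) = g x - g y.
Proof.
by move=> ge; rewrite addrC -scaleN1r (emb_linear ge) scaleN1r addrC.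
Qed.

Lemma unitaryM (R : realType) (A : starAlgType R) (v w : A) :
  unitary v -> unitary w -> unitary (v * w).
Proof.
move=> [v1 v2] [w1 w2]; split; rewrite starM.
  by rewrite mulrA -[_ * _ * v]mulrA v1 mulr1.
by rewrite mulrA -[_ * _ * star w]mulrA w2 mulr1.
Qed.

Theorem theorem1 (R : realType) (M : tracialVNA R)
    (M_II1 : II1_factor M) (M_sep : separable_tracial M)
    (M_ec : existentially_closed M)
    (f : M -> M) (f_emb : embedding f) (F : set M) (F_fin : finite_set F)
    (eps : R) (eps_gt0 : 0 < eps) :
  exists2 v : M, unitary v &
    forall x, F x -> norm2 (v * f x * star v - x) < eps.
Proof.
have /finite_seqP[r Fr] := F_fin.
pose B := \sum_(x <- r) norm2sq x.
have rB x : x \in r -> norm2sq x <= B.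
  move=> xr; rewrite /B (big_rem x)//= lerDl sumr_ge0// => y _.
  exact: norm2sq_ge0.
have [n nB] : exists n, n.+1%:R^-1 * (4 * B) < eps ^+ 2.
  exists (Num.truncn (4 * B / eps ^+ 2)).
  rewrite ltr_pdivrMl ?ltr0n// -ltr_pdivrMr ?exprn_gt0//.
  exact: truncnS_gt.
have [s [t [ss tt shift]]] := orbit_diag_shift n f_emb.
have [I [U [g [ge gj]]]] := M_ec _ _ (orbit_diag_embedding n f_emb).
have lift (k : amplification M n) : star k = - k /\ k * k = -1 ->
    exists w : linfty M I, (forall i, unitary (w i)) /\ ultra_class U w = g k.
  case=> kN k2; have gN x : g (- x) = - g x.
    by rewrite -[- x]add0r embeddingB// -[0](subrr 0) embeddingB// subrr sub0r.
  apply: lift_complex_structure; first by rewrite -(emb_star ge) kN gN.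
  by rewrite -(embM ge) k2 gN (emb1 ge).
have [w [wu wE]] := lift _ (perm_amp_complex_structure M ss).
have [z [zu zE]] := lift _ (perm_amp_complex_structure M tt).
(* Conjugation by [v] is conjugation by [g c], since ['i * 'i = -1]. *)
pose v := linfty_mul w z; pose j := orbit_diag n f.
pose c := perm_amp M s * perm_amp M t.
pose y x := linfty_mul (linfty_mul v (linfty_cst I (f x))) (linfty_star v) -
  linfty_cst I x.
have vE : ultra_class U v = g (- c).
  rewrite ultra_classM wE zE -(embM ge); congr g.
  by rewrite -scalerAl -scalerAr scalerA -expr2 sqrCi scaleN1r.
have yE x : ultra_class U (y x) = g (c * j (f x) * star c - j x).
  rewrite ultra_classB 2!ultra_classM ultra_class_star vE.
  rewrite -[ultra_class _ (linfty_cst _ (f x))]gj.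
  rewrite -[ultra_class _ (linfty_cst _ x)]gj.
  rewrite -(emb_star ge) -!(embM ge) -embeddingB//.
  by rewrite Defs.starN mulrN !mulNr opprK.
have small x : x \in r ->
    \forall i \near ultra_set U, norm2sq (y x i) < eps ^+ 2.
  move=> xr; have := @cvg_norm2sq_class R M I U (y x).
  rewrite yE (norm2sq_embedding _ ge) => yc.
  have lt_eps : norm2sq (c * j (f x) * star c - j x) < eps ^+ 2.
    apply: le_lt_trans (shift x) _; apply: le_lt_trans nB.
    by rewrite ler_wpM2l ?invr_ge0// ler_wpM2l// rB.
  have d0 := lt_eps; rewrite -subr_gt0 in d0.
  have /cvgrPdist_lt/(_ _ d0) := yc; apply: filterS => i.
  by rewrite distrC ltr_norml => /andP[_]; rewrite ltrBlDr subrK.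
have : \forall i \near ultra_set U, forall x : seq_sub r,
    norm2sq (y (ssval x) i) < eps ^+ 2.
  by apply: filter_forall => x; apply: small; exact: ssvalP.
move=> /filter_ex[i yi]; exists (w i * z i); first exact: unitaryM.
move=> x; rewrite Fr /= => xr.
rewrite -[ltRHS]ger0_norm ?ltW// -sqrtr_sqr ltr_sqrt ?exprn_gt0//.
exact: (yi (SeqSub xr)).
Qed.
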